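(* Let $W=(U,A_0,A_1,L,Y)$, let $V=(A_0,A_1,L,Y)$ be the observed variables, and let $V_1,\dots,V_n$ be independent realizations of $V$. Let $H$ be the hypothesis (the ''no treatment effect'' null hypothesis expressed in terms of the observables) that both (a) $f(y\mid \ell,a_0,a_1)=f(y\mid \ell,a_0)$, and (b) $\sum_{\ell=0}^1 f(y\mid a_0,\ell)\,f(\ell\mid a_0)$ does not depend on $a_0$. Suppose that: (i) the data analyst tests $H$ using the parametric models $$Y\mid a_0,a_1,\ell;\theta,\sigma^2\ \sim\ N(\theta_0+\theta_1a_0+\theta_2\ell+\theta_3a_1,\ \sigma^2),\qquad f(\ell=1\mid a_0;\gamma)=\frac{e^{\gamma_0+\gamma_1a_0}}{1+e^{\gamma_0+\gamma_1a_0}},$$ fit by the method of maximum likelihood; (ii) the no treatment effect null hypothesis represented by DAG 1b (defined in the context) is true, i.e. DAG 1b is the true causal graph generating the data; (iii) the distribution of $W$ is linearly faithful to DAG 1b. Then, with probability converging to $1$ (as $n\to\infty$), the null hypothesis $H$ will be falsely rejected.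
   Context: Variables: $A_0,A_1$ (treatment doses at two successive times) and $Y$ (outcome) are continuous real random variables, $L$ is binary with values in $\{0,1\}$, and $U$ is a hidden (unmeasured) random variable. $f(\cdot\mid\cdot)$ denotes the true conditional densities of the observed variables. The parametric models are not assumed to be correctly specified. DAG 1b is the directed acyclic graph on $\{U,A_0,L,A_1,Y\}$ with exactly the arrows $A_0\to L$, $A_0\to A_1$, $L\to A_1$, $U\to L$, $U\to Y$. The absence of arrows from $A_0$ and $A_1$ to $Y$ represents the hypothesis that the treatments $(A_0,A_1)$ have no effect on $Y$. When a DAG is the causal graph generating the data, the density of $W$ factors as the product over the vertices of the conditional density of each variable given its parents. When DAG 1b generates the data, $H$ holds. Linear faithfulness: the distribution of $W$ is linearly faithful to a DAG if for any disjoint (possibly empty) subsets $B,C,D$ of the variables in $W$, $B$ is d-separated from $C$ given $D$ on the DAG if and only if the partial correlation matrix between $B$ and $C$ given $D$ is the zero matrix. *)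

(* Defs.v *)
From HB Require Import structures.
From mathcomp Require Import all_boot all_order all_algebra.
From mathcomp Require Import all_classical all_reals all_analysis.

Set Implicit Arguments.
Unset Strict Implicit.
Unset Printing Implicit Defensive.

Import Order.TTheory GRing.Theory Num.Theory.
Import numFieldNormedType.Exports.

Local Open Scope classical_set_scope.
Local Open Scope ring_scope.

(** * Directed graphs on a finite type; [G i j] is the arrow [i -> j] *)

Section dseparation.
Variables (V : finType) (G : rel V).

Definition parents (v : V) : {set V} := [set u | G u v]%SET.

Definition adjacent : rel V := fun u v => G u v || G v u.

(* The vertex [b], met between [a] and [c] on a path, does not block the path
   given [D]: a collider is open iff it or one of its descendants is in [D]
   ([connect] is reflexive), a non-collider is open iff it is not in [D]. *)
Definition open_at (D : {set V}) (a b c : V) : bool :=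
  if G a b && G c b then [exists d in D, connect G b d] else b \notin D.

Definition active_path (D : {set V}) (x : V) (s : seq V) : Prop :=
  [/\ path adjacent x s, uniq (x :: s)
    & forall a b c, infix [:: a; b; c] (x :: s) -> open_at D a b c].

Definition d_separated (B C D : {set V}) : Prop :=
  forall x s, x \in B -> last x s \in C -> ~ active_path D x s.

End dseparation.

(** * Laws of finite families of real random variables *)

Section families.
Context d (T : measurableType d) (R : realType) (P : probability T R).
Variables (n : nat) (W : 'I_n -> {RV P >-> R}).

Definition cov_mx : 'M[R]_n := \matrix_(i, j) fine (covariance P (W i) (W j)).

Definition cov_block (B C : {set 'I_n}) : 'M[R]_(#|B|, #|C|) :=
  mxsub (@enum_val _ (mem B)) (@enum_val _ (mem C)) cov_mx.

(* Covariance matrix of the residuals of the linear regressions of [W_B] and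
   [W_C] on [W_D]. *)
Definition partial_cov (B C D : {set 'I_n}) : 'M[R]_(#|B|, #|C|) :=
  cov_block B C - cov_block B D *m invmx (cov_block D D) *m cov_block D C.

(* Division by zero gives [0] and [invmx] is the identity on singular matrices,
   so that this is only meaningful for a nonsingular [cov_mx].  Nonsingularity
   follows from [linearly_faithful] below when [G] is connected and has two
   nonadjacent vertices d-separated by all the others: for a minimal dependent
   set [S] of variables, a variable in [S] has partial correlation [0] with any
   variable outside [S] given the rest of [S], and partial correlation [1] or
   [-1] with the other variables of [S] given the remaining ones. *)
Definition partial_corr (B C D : {set 'I_n}) : 'M[R]_(#|B|, #|C|) :=
  \matrix_(i, j) (partial_cov B C D i j /
    (Num.sqrt (partial_cov B B D i i) * Num.sqrt (partial_cov C C D j j))).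

(* Square integrability is what makes the partial correlations meaningful. *)
Definition linearly_faithful (G : rel 'I_n) : Prop :=
  (forall v, (W v : T -> R) \in Lfun P 2%:E) /\
  forall B C D : {set 'I_n},
    (B :&: C = finset.set0)%SET -> (B :&: D = finset.set0)%SET ->
    (C :&: D = finset.set0)%SET ->
    (d_separated G B C D <-> partial_corr B C D = 0).

(** Densities are taken with respect to a reference measure [mu v] for each
    coordinate [v]. *)

Variable mu : 'I_n -> {measure set (measurableTypeR R) -> \bar R}.

Definition upd (w : n.-tuple R) (v : 'I_n) (x : R) : n.-tuple R :=
  [tuple if i == v then x else tnth w i | i < n].

(* Integral over the box [\prod_v B v] with respect to the product of the
   [mu v], as an iterated integral. *)
Definition box_integral (B : 'I_n -> set R) (f : n.-tuple R -> \bar R) : \bar R :=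
  foldr (fun v (g : n.-tuple R -> \bar R) w =>
           (\int[mu v]_(x in B v) g (upd w v x))%E)
        f (enum 'I_n) [tuple 0 | _ < n].

Definition is_joint_density (f : n.-tuple R -> R) : Prop :=
  [/\ measurable_fun [set: n.-tuple R] f, (forall w, 0 <= f w)
    & forall B : 'I_n -> set R, (forall v, measurable (B v)) ->
        P (\bigcap_(v in [set: 'I_n]) (W v @^-1` B v)) =
        box_integral B (EFin \o f)].

(* [p] is (a version of) the conditional density of [W v] given [W_D].  It is
   a function of a point of [R^n] that only reads the coordinates in
   [v |: D]; the events [\bigcap_(u in D) W u @^-1` B u] form a pi-system
   that generates the sigma-algebra of [W_D]. *)
Definition is_cond_density (v : 'I_n) (D : {set 'I_n})
    (p : n.-tuple R -> R) : Prop :=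
  [/\ measurable_fun [set: n.-tuple R] p,
      (forall w, 0 <= p w),
      (forall w w' : n.-tuple R,
         (forall u, u \in (v |: D)%SET -> tnth w u = tnth w' u) -> p w = p w'),
      (forall w, (\int[mu v]_x (p (upd w v x))%:E = 1)%E)
    & forall B : 'I_n -> set R, (forall u, measurable (B u)) ->
        P (\bigcap_(u in [set` (v |: D)%SET]) (W u @^-1` B u)) =
        (\int[P]_(t in \bigcap_(u in [set` D]) (W u @^-1` B u))
           \int[mu v]_(x in B v) (p (upd [tuple W i t | i < n] v x))%:E)%E].

Definition factors_along (G : rel 'I_n) : Prop :=
  exists p : 'I_n -> n.-tuple R -> R,
    (forall v, is_cond_density v (parents G v) (p v)) /\
    is_joint_density (fun w => \prod_(v < n) p v w).

End families.

Definition mutually_independent d (T : measurableType d) (R : realType)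
    (P : probability T R) d' (T' : measurableType d')
    (X : nat -> {RV P >-> T'}) : Prop :=
  forall (s : seq nat) (A : nat -> set T'),
    uniq s -> (forall i, measurable (A i)) ->
    P (\big[setI/setT]_(i <- s) (X i @^-1` A i)) =
    (\prod_(i <- s) P (X i @^-1` A i))%E.

(** * DAG 1b and the law of [W = (U, A0, L, A1, Y)] *)

Definition vU  : 'I_5 := @Ordinal 5 0 isT.
Definition vA0 : 'I_5 := @Ordinal 5 1 isT.
Definition vL  : 'I_5 := @Ordinal 5 2 isT.
Definition vA1 : 'I_5 := @Ordinal 5 3 isT.
Definition vY  : 'I_5 := @Ordinal 5 4 isT.

Definition DAG1b : rel 'I_5 := fun i j =>
  (i, j) \in [:: (vA0, vL); (vA0, vA1); (vL, vA1); (vU, vL); (vU, vY)].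

(* [A0], [A1] and [Y] are continuous: Lebesgue reference measure.  [L] is
   binary: counting measure on [{0, 1}].  The nature of the hidden variable [U]
   is left open. *)
Definition reference_measure (R : realType)
    (muU : {sigma_finite_measure set (measurableTypeR R) -> \bar R})
    (v : 'I_5) : {measure set (measurableTypeR R) -> \bar R} :=
  if v == vU then (muU : {measure set (measurableTypeR R) -> \bar R})
  else if v == vL then (measure_add \d_(0 : measurableTypeR R) \d_(1 : measurableTypeR R) : {measure set (measurableTypeR R) -> \bar R})
  else (lebesgue_measure : {measure set (measurableTypeR R) -> \bar R}).

(** * The hypothesis [H] *)

(* Arguments: [fY y a0 l a1] is [f(y | l, a0, a1)], [fY' y a0 l] is
   [f(y | l, a0)] and [fL l a0] is [f(l | a0)]. *)
Definition null_hypothesis (R : realType) (fY : R -> R -> R -> R -> R)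
    (fY' : R -> R -> R -> R) (fL : R -> R -> R) : Prop :=
  (forall (y a0 a1 : R) (l : bool), fY y a0 l%:R a1 = fY' y a0 l%:R) /\
  (forall y a0 a0' : R,
     \sum_(l : bool) fY' y a0 l%:R * fL l%:R a0 =
     \sum_(l : bool) fY' y a0' l%:R * fL l%:R a0').

(* Conditional densities are defined up to null sets: [H] holds for a law when
   it holds for suitable versions of them. *)
Definition true_null d (T : measurableType d) (R : realType)
    (P : probability T R) (muU : {sigma_finite_measure set (measurableTypeR R) -> \bar R})
    (W : 'I_5 -> {RV P >-> R}) : Prop :=
  let mu := reference_measure muU in
  exists fY fY' fL,
    [/\ is_cond_density W mu vY [set vL; vA0; vA1]%SET
          (fun w => fY (tnth w vY) (tnth w vA0) (tnth w vL) (tnth w vA1)),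
        is_cond_density W mu vY [set vL; vA0]%SET
          (fun w => fY' (tnth w vY) (tnth w vA0) (tnth w vL)),
        is_cond_density W mu vL [set vA0]%SET
          (fun w => fL (tnth w vL) (tnth w vA0))
      & null_hypothesis fY fY' fL].

(** * The parametric models and the likelihood ratio test of [H] *)

Record param (R : realType) := Param {
  theta0 : R; theta1 : R; theta2 : R; theta3 : R;
  sigma2 : R;
  gamma0 : R; gamma1 : R }.

Section models.
Variable R : realType.
Implicit Types tau : param R.

(* [normal_pdf] takes the standard deviation. *)
Definition model_Y tau (y a0 l a1 : R) : R :=
  normal_pdf (theta0 tau + theta1 tau * a0 + theta2 tau * l + theta3 tau * a1)
    (Num.sqrt (sigma2 tau)) y.

Definition model_L tau (l a0 : R) : R :=
  let e := expR (gamma0 tau + gamma1 tau * a0) in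
  if l == 1 then e / (1 + e) else 1 - e / (1 + e).

Definition param_space : set (param R) := [set tau | 0 < sigma2 tau].

(* Parameters whose model densities satisfy [H].  By (a), [fY'] is forced to be
   the common value over [a1] of [f(y | l, a0, a1)], which is indeed
   [f(y | l, a0)] whatever the law of [A1] is. *)
Definition null_space : set (param R) :=
  param_space `&`
  [set tau | exists fY', null_hypothesis (model_Y tau) fY' (model_L tau)].

(* A data point is [(a0, a1, l, y)].  The law of [(A0, A1)] is not modelled, so
   this is the log-likelihood up to a term free of [tau]. *)
Definition loglik (n : nat) (v : nat -> R * R * R * R) tau : R :=
  \sum_(i < n) (let: (a0, a1, l, y) := v i in
                ln (model_Y tau y a0 l a1) + ln (model_L tau l a0)).

Definition max_loglik (n : nat) (v : nat -> R * R * R * R)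
    (Theta : set (param R)) : \bar R :=
  ereal_sup [set (loglik n v tau)%:E | tau in Theta].

(* Twice the log-likelihood ratio of the unrestricted fit to the fit under [H].
   When both are infinite (degenerate samples) [+oo - +oo = -oo]: no
   rejection. *)
Definition LR_statistic (n : nat) (v : nat -> R * R * R * R) : \bar R :=
  (2%:E * (max_loglik n v param_space - max_loglik n v null_space))%E.

Definition rejects (c : R) (n : nat) (v : nat -> R * R * R * R) : Prop :=
  (c%:E < LR_statistic n v)%E.

End models.

(* Main.v *)
Require Import Defs.
From HB Require Import structures.
From mathcomp Require Import all_boot all_order all_algebra.
From mathcomp Require Import all_classical all_reals all_analysis.
From mathcomp Require Import measurable_realfun simple_functions ring lra.
Set Implicit Arguments.
Unset Strict Implicit.
Unset Printing Implicit Defensive.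
Import Order.TTheory GRing.Theory Num.Theory.
Import numFieldNormedType.Exports.
Local Open Scope classical_set_scope.
Local Open Scope ring_scope.

(* Write the joint density along the DAG as
     p(u) p(a0) p(l | u, a0) p(a1 | a0, l) p(y | u).
   Integrating [u] out, f(y | l, a0, a1) does not depend on [a1], and the sum over
   [l] of f(y | a0, l) f(l | a0) is the integral of p(y | u) p(u), which does not
   depend on [a0]: [H] holds.

   A model law satisfying [H] has theta3 = 0, and theta1 = 0 as well: otherwise
   the mixture of two normal densities in (b) tends to 0 as [a0] grows.  So under
   [H] the fitted mean of [Y] is an affine function of [L].  But [L] is a collider
   on A0 -> L <- U -> Y, so by faithfulness the partial correlation of [A0] and
   [Y] given [L] is nonzero, and adding [A0] to the regression of [Y] on [(1, L)]
   lowers the residual variance from [v0] to some [vs < v0].  For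
   [vs < s1 < s < v0], by the weak law of large numbers and with probability
   tending to 1, every law in the null model (with [L]-parameters [gamma]) is
   beaten, by [n (ln s - ln s1) / 2] in log-likelihood, by a law with the same
   [gamma]: the likelihood ratio statistic tends to infinity in probability. *)

(** * The weak law of large numbers *)

(** No maximizer of either likelihood is ever found. On each stratum of [L] the mean squared
    residual of a null law is a quadratic in one shift of the mean; completing the square bounds it
    below, uniformly in the parameters, by a function of five sample means. A sixth mean is the
    squared residual of one fixed competitor. Six uses of the weak law thus replace uniform laws and
    the asymptotic theory of estimators. The competitor perturbs the regression of [Y] on [(1, L)]
    along [A0] only: any strict decrease of the variance is enough. Faithfulness provides second
    moments only, so squared residuals are merely integrable and the weak law must hold for
    integrable functions: Chebyshev serves for indicators, linearity for simple functions, and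
    Markov for the approximation error in mean. The truth of H meets another obstacle:
    [null_hypothesis] asks for equalities at every point, while conditional densities are determined
    up to null sets, so versions must be chosen on the exceptional sets. *)

Section wlln_events.
Context d (T : measurableType d) (R : realType) (P : probability T R).

Lemma indic_Lfun2 (A : set T) : measurable A -> (\1_A : T -> R) \in Lfun P 2%:E.
Proof.
move=> mA; rewrite inE; apply/andP; split; rewrite inE/=; first exact: measurable_indic.
rewrite /finite_norm unlock poweR_lty//.
apply: (@le_lt_trans _ _ (\int[P]_x (cst 1%E x))%E).
  apply: ge0_le_integral => //=.
  - apply/measurable_EFinP.
    apply/(@measurableT_comp _ _ _ _ _ _ (fun x : R => x `^ 2)%R) => //.
    exact/measurableT_comp.
  - move=> x _; rewrite indicE lee_fin.
    by case: (x \in A); rewrite ?normr0 ?normr1 ?powR1// powR0.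
by rewrite integral_cst//= probability_setT mule1 ltry.
Qed.

Variables (A : nat -> set T) (p : R).
Hypothesis mA : forall i, measurable (A i).
Hypothesis PA : forall i, P (A i) = p%:E.
Hypothesis PAA : forall i j, i != j -> P (A i `&` A j) = (p * p)%:E.

Let S n : T -> R := fun t => \sum_(i < n) \1_(A i) t.

Let S_succ n : S n.+1 = S n \+ \1_(A n).
Proof. by apply/funext => t; rewrite /S big_ord_recr. Qed.

Let S0 : S 0 = cst 0.
Proof. by apply/funext => t; rewrite /S big_ord0. Qed.

Let S_Lfun2 n : S n \in Lfun P 2%:E.
Proof.
elim: n => [|n IH]; first by rewrite S0 Lfun_cst.
by rewrite S_succ rpredD//= ?lee1n// indic_Lfun2.
Qed.

Let fP : P setT \is a fin_num := fin_num_measure P _ measurableT.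

Let indic_Lfun1 i : (\1_(A i) : T -> R) \in Lfun P 1.
Proof. exact: (Lfun_subset12 fP (indic_Lfun2 (mA i))). Qed.

Let S_Lfun1 n : S n \in Lfun P 1.
Proof. exact: (Lfun_subset12 fP (S_Lfun2 n)). Qed.

Let ES n : ('E_P[S n] = (n%:R * p)%:E)%E.
Proof.
elim: n => [|n IH]; first by rewrite S0 expectation_cst mul0r.
rewrite S_succ expectationD// IH expectation_indic// PA -EFinD.
by rewrite -natr1 mulrDl mul1r.
Qed.

Let cov_indic i j : covariance P (\1_(A i)) (\1_(A j)) =
  (if i == j then p - p * p else 0)%:E.
Proof.
have ind_mul : (\1_(A i) * \1_(A j) : T -> R) = \1_(A i `&` A j).
  by rewrite indicI.
rewrite covarianceE//; last first.
  rewrite ind_mul; apply: (Lfun_subset12 fP); apply: indic_Lfun2.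
  exact: measurableI.
rewrite ind_mul !expectation_indic//; last exact: measurableI.
rewrite !PA; have [->|ij] := eqVneq i j; first by rewrite setIid PA.
by rewrite PAA// -EFinM -EFinB subrr.
Qed.

Let cov_S n j : (n <= j)%N -> covariance P (S n) (\1_(A j)) = 0%E.
Proof.
elim: n => [_|n IH nj]; first by rewrite S0 covariance_cst_l.
rewrite S_succ covarianceDl ?indic_Lfun2// IH ?(ltnW nj)// cov_indic.
by rewrite lt_eqF// adde0.
Qed.

Let VS n : ('V_P[S n] = (n%:R * (p - p * p))%:E)%E.
Proof.
elim: n => [|n IH]; first by rewrite S0 variance_cst mul0r.
rewrite S_succ varianceD ?indic_Lfun2// cov_S// mule0 adde0 IH.
rewrite /variance cov_indic eqxx -EFinD.
by rewrite -natr1 mulrDl mul1r.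
Qed.

(** Pairwise independence is all that Chebyshev's inequality uses: the variance of the sum is
    [n (p - p^2)], at most [n], so the bound is [1 / (e^2 n)]. *)
Lemma wlln_events (e : R) (dl : R) : 0 < e -> 0 < dl ->
  \forall n \near \oo, (P [set t | (e <= `|n%:R^-1 * (\sum_(i < n) \1_(A i) t) - p|)%R]
     <= dl%:E)%E.
Proof.
move=> e0 dl0.
near=> n.
have n0 : 0 < n%:R :> R.
  by rewrite ltr0n; near: n; exact: nbhs_infty_gt.
have mS : measurable_fun setT (S n).
  by have := S_Lfun2 n; rewrite inE => /andP[+ _]; rewrite inE.
pose X := [the {mfun T >-> R} of mfun_Sub (mem_set mS)].
have en0 : 0 < e * n%:R by rewrite mulr_gt0.
have := @chebyshev _ _ _ P X _ en0.
rewrite (_ : 'V_P[X] = 'V_P[S n])%E // (_ : 'E_P[X] = 'E_P[S n])%E // VS ES/=.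
rewrite (_ : [set x | _] = [set t | e <= `|n%:R^-1 * (\sum_(i < n) \1_(A i) t) - p|]); last first.
  apply/seteqP; split => t /=.
    rewrite -ler_pdivlMr// => /le_trans; apply.
    rewrite -[X in _ / X]gtr0_norm// -normf_div mulrBl mulrC mulrAC divff ?gt_eqF//.
    by rewrite mul1r.
  move=> h; rewrite -ler_pdivlMr//; apply: (le_trans h).
  rewrite -[X in _ / X]gtr0_norm// -normf_div mulrBl mulrC mulrAC divff ?gt_eqF//.
  by rewrite mul1r.
move=> /le_trans; apply; rewrite lee_fin.
have pp : p - p * p <= 1.
  have : 0 <= (p - 1/2)^+2 by exact: sqr_ge0.
  lra.
have hn : dl^-1 / e ^+ 2 <= n%:R.
  near: n; exact: nbhs_infty_ger.
apply: (@le_trans _ _ ((e * n%:R) ^- 2 * n%:R)).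
  by rewrite ler_pM2l ?invr_gt0 ?exprn_gt0// ler_piMr// ltW.
rewrite exprMn.
rewrite ler_pdivrMr ?exprn_gt0// in hn.
rewrite invfM -mulrA (_ : (n%:R ^-2) * n%:R = n%:R^-1); last first.
  by rewrite expr2 invfM -mulrA mulVf ?mulr1// gt_eqF.
rewrite -invfM -[leRHS]invrK lef_pV2 ?posrE ?invr_gt0 ?mulr_gt0 ?exprn_gt0//.
by rewrite mulrC.
Unshelve. all: by end_near.
Qed.

End wlln_events.

(** * Sample means of independent observations, from indicators to integrable functions *)

Section wlln.
Context d (T : measurableType d) (R : realType) (P : probability T R).
Context d' (T' : measurableType d') (mu : probability T' R).
Variable V : nat -> {RV P >-> T'}.
Hypothesis V_indep : mutually_independent V.
Hypothesis V_law : forall i (A : set T'), measurable A -> P (V i @^-1` A) = mu A.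

Definition sample_mean (n : nat) (h : T' -> R) (t : T) : R :=
  n%:R^-1 * \sum_(i < n) h (V i t).

Lemma measurable_sample_mean n (h : T' -> R) : measurable_fun setT h ->
  measurable_fun setT (sample_mean n h).
Proof.
move=> mh; apply: measurable_funM => //; apply: measurable_sum => i.
exact: measurableT_comp.
Qed.

Definition deviation (n : nat) (h : T' -> R) (m e : R) : set T :=
  [set t | e <= `|sample_mean n h t - m|].

Lemma measurable_deviation n h m e : measurable_fun setT h ->
  measurable (deviation n h m e).
Proof.
move=> mh; rewrite /deviation.
have mf : measurable_fun setT (fun t => `|sample_mean n h t - m|).
  apply: measurableT_comp => //; apply: measurable_funB => //.
  exact: measurable_sample_mean.
have := mf measurableT _ (measurable_itv `[e, +oo[).
rewrite setTI; congr measurable; apply/seteqP; split => t /=;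
  by rewrite in_itv/= andbT.
Qed.

(** Convergence in probability of the sample means, bundled with measurability so that the class of
    such [h] is closed under linear combinations; this carries the law from indicators to simple
    functions. *)
Definition obeys_wlln (h : T' -> R) (m : R) : Prop :=
  measurable_fun setT h /\
  forall e dl, 0 < e -> 0 < dl ->
    \forall n \near \oo, (P (deviation n h m e) <= dl%:E)%E.

Lemma obeys_wlln_cst0 : obeys_wlln (cst 0) 0.
Proof.
split=> // e dl e0 dl0; near=> n.
rewrite (_ : deviation _ _ _ _ = set0) ?measure0 ?lee_fin ?ltW//.
apply/seteqP; split => t //=; rewrite /deviation/= /sample_mean big1//.
by rewrite mulr0 subrr normr0 leNgt e0.
Unshelve. all: by end_near. Qed.

Lemma obeys_wllnD h1 h2 m1 m2 : obeys_wlln h1 m1 -> obeys_wlln h2 m2 ->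
  obeys_wlln (h1 \+ h2) (m1 + m2).
Proof.
move=> [mh1 H1] [mh2 H2]; split; first exact: measurable_funD.
move=> e dl e0 dl0.
have e20 : 0 < e / 2 by rewrite divr_gt0.
have dl20 : 0 < dl / 2 by rewrite divr_gt0.
near=> n.
have D1 : (P (deviation n h1 m1 (e / 2)) <= (dl / 2)%:E)%E by near: n; exact: H1.
have D2 : (P (deviation n h2 m2 (e / 2)) <= (dl / 2)%:E)%E by near: n; exact: H2.
rewrite [dl]splitr EFinD; apply: le_trans (leeD D1 D2).
have M1 := measurable_deviation n m1 (e / 2) mh1.
have M2 := measurable_deviation n m2 (e / 2) mh2.
apply: le_trans (measureU2 _ M1 M2).
apply: le_measure; rewrite ?inE.
- by apply: measurable_deviation; apply: measurable_funD.
- exact: measurableU.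
move=> t; rewrite /deviation /=.
have -> : sample_mean n (h1 \+ h2) t = sample_mean n h1 t + sample_mean n h2 t.
  by rewrite /sample_mean -mulrDr -big_split.
move: (sample_mean n h1 t) (sample_mean n h2 t) => a b h.
have [ha|ha] := leP (e / 2) `|a - m1|; first by left.
right.
rewrite leNgt; apply/negP => hb.
have := ler_normD (a - m1) (b - m2).
rewrite (_ : a - m1 + (b - m2) = a + b - (m1 + m2)); last by ring.
by lra.
Unshelve. all: by end_near. Qed.

Lemma obeys_wllnZ k h m : obeys_wlln h m -> obeys_wlln (k \*o h) (k * m).
Proof.
move=> [mh H]; split; first exact: measurable_funM.
move=> e dl e0 dl0.
(* Dividing by [|k| + 1] rather than [|k|] covers [k = 0]. *)
have k0 : 0 < `|k| + 1 by rewrite ltr_wpDl.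
have ek0 : 0 < e / (`|k| + 1) by rewrite divr_gt0.
near=> n.
have D : (P (deviation n h m (e / (`|k| + 1))) <= dl%:E)%E by near: n; exact: H.
apply: le_trans D; apply: le_measure; rewrite ?inE.
- by apply: measurable_deviation; apply: measurable_funM.
- exact: measurable_deviation.
move=> t; rewrite /deviation/= => he.
have E : sample_mean n (k \*o h) t - k * m = k * (sample_mean n h t - m).
  rewrite /sample_mean mulrBr; congr (_ - _).
  by rewrite mulrCA; congr (_ * _); rewrite big_distrr.
rewrite E normrM in he; rewrite ler_pdivrMr//; apply: (le_trans he).
by rewrite mulrC ler_wpM2l// lerDl.
Unshelve. all: by end_near. Qed.

Lemma obeys_wlln_indic (A : set T') : measurable A ->
  obeys_wlln (\1_A) (fine (mu A)).
Proof.
move=> mA; split; first exact: measurable_indic.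
have muA : mu A = (fine (mu A))%:E by rewrite fineK// fin_num_measure.
have PA i : P (V i @^-1` A) = (fine (mu A))%:E by rewrite V_law.
have mVA i : measurable (V i @^-1` A).
  by rewrite -[X in measurable X]setTI; exact: measurable_funP.
have PAA i j : i != j -> P (V i @^-1` A `&` V j @^-1` A) =
    (fine (mu A) * fine (mu A))%:E.
  move=> ij; have := @V_indep [:: i; j] (fun=> A).
  rewrite !big_cons !big_nil setIT mule1 !V_law// muA => -> //=.
  by rewrite inE ij.
move=> e dl e0 dl0; exact: (wlln_events mVA PA PAA e0 dl0).
Qed.

Lemma obeys_wlln_sum (I : Type) (r : seq I) (h : I -> T' -> R) (m : I -> R) :
  (forall i, obeys_wlln (h i) (m i)) ->
  obeys_wlln (fun x => \sum_(i <- r) h i x) (\sum_(i <- r) m i).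
Proof.
move=> H; elim: r => [|i r IH].
  rewrite big_nil (_ : (fun x => _) = cst 0); first exact: obeys_wlln_cst0.
  by apply/funext => x; rewrite big_nil.
rewrite big_cons (_ : (fun x => _) = h i \+ (fun x => \sum_(i <- r) h i x)).
  exact: obeys_wllnD.
by apply/funext => x; rewrite big_cons.
Qed.

Import HBSimple.

Lemma obeys_wlln_sfun (g : {sfun T' >-> R}) :
  obeys_wlln g (fine (\int[mu]_x (g x)%:E)%E).
Proof.
pose r : seq R := finmap.enum_fset (fset_set (range g)).
pose h (k : R) : T' -> R := k \*o \1_(g @^-1` [set k]).
have gE : (g : T' -> R) = (fun x => \sum_(k <- r) h k x).
  by apply/funext => x; rewrite /h {1}(fimfunE g x) fsbig_finite//=.
have mg k : measurable (g @^-1` [set k]) by exact: measurable_funPTI.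
rewrite (_ : fine _ = \sum_(k <- r) k * fine (mu (g @^-1` [set k]))).
  by rewrite {1}gE; apply: obeys_wlln_sum => k; apply/obeys_wllnZ/obeys_wlln_indic.
under eq_integral do rewrite gE -sumEFin.
rewrite integral_sum//=.
  rewrite -sum_fine//.
    apply: eq_bigr => k _; rewrite /h.
    under eq_integral do rewrite EFinM.
    by rewrite integralZl//=; [rewrite integral_indic// setIT fineM// fin_num_measure
      |exact: integrable_indic].
  move=> k _; rewrite /h; under eq_integral do rewrite EFinM.
  rewrite integralZl//=; last exact: integrable_indic.
  by rewrite integral_indic// setIT fin_numM// fin_num_measure.
move=> k; rewrite /h; under eq_fun do rewrite EFinM.
by apply: integrableZl => //; exact: integrable_indic.
Qed.

Lemma ge0_integral_law i (f : T' -> \bar R) : measurable_fun setT f ->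
  (forall x, 0 <= f x)%E -> (\int[P]_t f (V i t) = \int[mu]_x f x)%E.
Proof.
move=> mf f0; rewrite -[LHS](@ge0_integral_pushforward _ _ _ _ _ _
  (measurable_funPT (V i)) P setT f)//.
by apply: eq_measure_integral => A mA _; exact: V_law.
Qed.

(** Controls, with a bound free of [n], the price of replacing an integrable function by a simple
    one; it asks for a first moment only. *)
Lemma markov_sample_mean n (f : T' -> R) (c e : R) : (0 < n)%N -> 0 < e ->
  measurable_fun setT f -> (forall x, 0 <= f x) ->
  (\int[mu]_x (f x)%:E <= c%:E)%E ->
  (P [set t | (e <= sample_mean n f t)%R] <= (c / e)%:E)%E.
Proof.
move=> n0 e0 mf f0 fc.
have mS := measurable_sample_mean n mf.
have S0 t : 0 <= sample_mean n f t.
  by rewrite mulr_ge0 ?invr_ge0//; apply: sumr_ge0.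
pose X := [the {mfun T >-> R} of mfun_Sub (mem_set mS)].
have := @markov _ _ _ P X id _ e0 (@measurable_id _ _ _) (fun _ => id).
rewrite (_ : [set x | _] = [set t | (e <= sample_mean n f t)%R]); last first.
  by apply/seteqP; split => t /=; rewrite ger0_norm.
have -> : ('E_P[id \o (fun x => `|x|%R) \o X] = \int[mu]_x (f x)%:E)%E.
  rewrite unlock.
  under eq_integral => t _ do rewrite /= ger0_norm// /sample_mean EFinM -sumEFin.
  rewrite ge0_integralZl//=; first last.
  - by move=> t _; apply: sume_ge0 => i _; rewrite lee_fin.
  - apply: emeasurable_sum => i; apply/measurable_EFinP; exact: measurableT_comp.
  rewrite (@ge0_integral_sum _ _ _ P _ measurableT _
    (fun (i : 'I_n) x => (f (V i x))%:E))//=; first last.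
  - by move=> i t _; rewrite lee_fin.
  - move=> i; apply/measurable_EFinP; exact: measurableT_comp.
  rewrite (eq_bigr (fun=> \int[mu]_x (f x)%:E)%E); last first.
    move=> i _; apply: (ge0_integral_law i (f := EFin \o f)); first exact/measurable_EFinP.
    by move=> x; rewrite lee_fin.
  have /fineK <- : (\int[mu]_x (f x)%:E)%E \is a fin_num.
    by rewrite ge0_fin_numE ?(le_lt_trans fc) ?ltry//; apply: integral_ge0 => x _; rewrite lee_fin.
  rewrite sumEFin -EFinM sumr_const card_ord -[X in _ * X]mulr_natl mulrA mulVf ?mul1r//.
  by rewrite pnatr_eq0 -lt0n.
rewrite EFinM muleC => h; rewrite lee_pdivlMr//.
by apply: le_trans fc; apply: h => x y.
Qed.

Theorem weak_law (h : T' -> R) : mu.-integrable setT (EFin \o h) ->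
  obeys_wlln h (fine (\int[mu]_x (h x)%:E)%E).
Proof.
move=> ih.
have mh : measurable_fun setT h.
  by apply/measurable_EFinP; exact: measurable_int ih.
split=> // e dl e0 dl0.
(* [e / 4] bounds the difference of the two integrals; [dl * e / 8] makes Markov's bound at level
   [e / 4] at most [dl / 2]. Three errors of size [e / 4] add up to less than [e]. *)
pose eta := Num.min (e / 4) (dl * e / 8).
have eta0 : 0 < eta by rewrite lt_min !divr_gt0// mulr_gt0.
have [g_ [ig _ gcvg]] := approximation_sfun_integrable measurableT ih.
have [N hN] : exists N, (\int[mu]_x `|(h x)%:E - (g_ N x)%:E| < eta%:E)%E.
  have /fine_cvgP[F1 /cvgrPdist_lt /(_ _ eta0) F2] := gcvg.
  have [N _ /(_ N (leqnn N)) [f1 f2]] : \forall n \near \oo,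
    (\int[mu]_x `|(h x)%:E - (g_ n x)%:E|)%E \is a fin_num /\
    (fine (\int[mu]_x `|(h x)%:E - (g_ n x)%:E|)%E < eta).
    near=> n; split; first by near: n.
    have : `|0 - fine (\int[mu]_x `|(h x)%:E - (g_ n x)%:E|)%E| < eta by near: n.
    by rewrite sub0r normrN; apply: le_lt_trans; exact: ler_norm.
  by exists N; rewrite -(fineK f1) lte_fin.
set g := g_ N in hN; have mg : measurable_fun setT g by exact: measurable_funP.
have hgE : (\int[mu]_x (`|h x - g x|)%:E < eta%:E)%E.
  by under eq_integral do rewrite -abse_EFin EFinB.
have IE : `|fine (\int[mu]_x (h x)%:E) - fine (\int[mu]_x (g x)%:E)| <= e / 4.
  rewrite -fineB ?integrable_fin_num//; last exact: (ig N).
  rewrite -integralB//; last exact: (ig N).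
  rewrite -lee_fin -abse_EFin fineK; last first.
    by apply: integrable_fin_num => //; apply: integrableB => //; exact: (ig N).
  apply: le_trans (le_abse_integral _ _ _) _ => //.
    by apply: measurable_int (integrableB _ ih (ig N)).
  by apply: ltW; apply: lt_le_trans hN _; rewrite lee_fin ge_min lexx.
have [_ /(_ (e / 4) (dl / 2))] := obeys_wlln_sfun g.
rewrite !divr_gt0// => /(_ isT isT) Hg.
have mhg : measurable_fun setT (fun x => `|h x - g x|).
  by apply: measurableT_comp => //; exact: measurable_funB.
near=> n.
have n0 : (0 < n)%N by near: n; exact: nbhs_infty_gt.
have D1 : (P (deviation n g (fine (\int[mu]_x (g x)%:E)%E) (e / 4)) <= (dl / 2)%:E)%E.
  by near: n.
have e40 : 0 < e / 4 by rewrite divr_gt0.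
have D2 := @markov_sample_mean n _ eta (e / 4) n0 e40 mhg (fun _ => normr_ge0 _) (ltW hgE).
have {}D2 : (P [set t | (e / 4 <= sample_mean n (fun x => `|h x - g x|) t)%R] <= (dl / 2)%:E)%E.
  apply: le_trans D2 _; rewrite lee_fin ler_pdivrMr//.
  rewrite ge_min; apply/orP; right; lra.
rewrite [dl]splitr EFinD; apply: le_trans (leeD D1 D2).
have M1 := measurable_deviation n (fine (\int[mu]_x (g x)%:E)%E) (e / 4) mg.
have M2 : measurable [set t | (e / 4 <= sample_mean n (fun x => `|h x - g x|) t)%R].
  have := measurable_sample_mean n mhg measurableT (measurable_itv `[e / 4, +oo[).
  rewrite setTI; congr measurable; apply/seteqP; split => t /=;
  by rewrite in_itv/= andbT.
apply: le_trans (measureU2 _ M1 M2).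
apply: le_measure; rewrite ?inE.
- exact: measurable_deviation.
- exact: measurableU.
move=> t; rewrite /deviation /=.
have := ler_norm_sum (index_enum 'I_n) (fun i => h (V i t) - g (V i t)) xpredT.
rewrite sumrB => K.
have {K} : `|sample_mean n h t - sample_mean n g t| <= sample_mean n (fun x => `|h x - g x|) t.
  by rewrite /sample_mean -mulrBr normrM ger0_norm ?invr_ge0// ler_wpM2l// invr_ge0.
move: IE; set a := sample_mean n h t; set b := sample_mean n g t.
set c := sample_mean n _ t; set x := fine _; set y := fine _ => hxy hab hax.
have [hb|hb] := leP (e / 4) `|b - y|; first by left.
right.
have := ler_normD (a - b) (b - y).
have := ler_normD (a - b + (b - y)) (y - x).
rewrite (_ : a - b + (b - y) + (y - x) = a - x); last by ring.
rewrite distrC in hxy; lra.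
Unshelve. all: by end_near. Qed.

End wlln.
(** * Consequences of linear faithfulness *)

Lemma enum_val_set1 (I : finType) (x : I) (i : 'I_#|[set x]%SET|) :
  enum_val i = x.
Proof. by have /set1P := enum_valP i. Qed.

(** [#|[set x]|] is only provably [1]; a matrix of this size is treated as a scalar matrix, whose
    inverse is explicit. *)
Lemma scalar_mx_set1 (R : nzRingType) (I : finType) (x : I)
    (A : 'M[R]_#|[set x]%SET|) (a : R) : (forall i j, A i j = a) -> A = a%:M.
Proof.
move=> Aa; apply/matrixP => i j; rewrite Aa mxE.
by rewrite (_ : i = j) ?eqxx//; apply: enum_val_inj; rewrite !enum_val_set1.
Qed.

Section singletons.
Context d (T : measurableType d) (R : realType) (P : probability T R).
Context (n : nat) (W : 'I_n -> {RV P >-> R}).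
Local Notation c x y := (cov_mx W x y).

(** The case [c z z = 0] is covered by default values: [invmx] leaves the singular block [0]
    unchanged, and [0^-1 = 0]. *)
Lemma partial_cov_set1 x y z :
  partial_cov W [set x] [set y] [set z] =
  const_mx (c x y - c x z / c z z * c z y).
Proof.
rewrite /partial_cov (@scalar_mx_set1 _ _ _ (cov_block W [set z] [set z]) (c z z)); last first.
  by move=> k l; rewrite !mxE !enum_val_set1.
rewrite invmx_scalar mul_mx_scalar -scalemxAl.
apply/matrixP => i j; rewrite mxE [in RHS]mxE; congr (_ + _).
  by rewrite !mxE !enum_val_set1.
rewrite 3!mxE [in RHS]mulrAC [in RHS]mulrC; congr (- (_ * _)).
rewrite mxE (eq_bigr (fun=> c x z * c z y)) ?sumr_const ?card_ord ?cards1//.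
by move=> k _; rewrite !mxE !enum_val_set1.
Qed.

Lemma partial_cov_set0 x y :
  partial_cov W [set x] [set y] finset.set0 = const_mx (c x y).
Proof.
apply/matrixP => i j; rewrite !mxE !enum_val_set1 big1 ?subr0// => k _.
by have := enum_valP k; rewrite inE.
Qed.

(** Used contraposed: a nonzero partial correlation has a nonzero numerator, whatever the
    normalizing square roots are. *)
Lemma partial_corr_set1_eq0 x y z : c x y - c x z / c z z * c z y = 0 ->
  partial_corr W [set x] [set y] [set z] = 0.
Proof.
by move=> e; apply/matrixP => i j; rewrite mxE (partial_cov_set1 x y) e !mxE mul0r.
Qed.

Lemma partial_corr_set0_eq0 x y : c x y = 0 ->
  partial_corr W [set x] [set y] finset.set0 = 0.
Proof.
by move=> e; apply/matrixP => i j; rewrite mxE (partial_cov_set0 x y) e !mxE mul0r.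
Qed.

End singletons.

(** A path of one arrow has no interior vertex, so nothing can block it. *)
Lemma DAG1b_A0_L_connected :
  ~ d_separated DAG1b [set vA0] [set vL] finset.set0.
Proof.
move/(_ vA0 [:: vL]); rewrite !inE/= => /(_ erefl erefl); apply; split=> //.
by move=> a b c /size_infix.
Qed.

(* The collider [L] on [A0 -> L <- U -> Y] is conditioned upon. *)
Lemma DAG1b_A0_Y_connected :
  ~ d_separated DAG1b [set vA0] [set vY] [set vL].
Proof.
move/(_ vA0 [:: vL; vU; vY]); rewrite !inE/= => /(_ erefl erefl).
apply; split=> // a b c.
rewrite infix_consl => /orP[|].
  rewrite prefixE /= => /eqP[<- <- <-]; rewrite /open_at /DAG1b /= .
  by apply/exists_inP; exists vL; rewrite ?inE// connect0.
rewrite infix_consl => /orP[|/size_infix//].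
by rewrite prefixE /= => /eqP[<- <- <-]; rewrite /open_at /= inE.
Qed.

Lemma disjoint_set1 (I : finType) (x y : I) : x != y ->
  ([set x] :&: [set y] = finset.set0)%SET.
Proof.
move=> xy; apply/setP => i; rewrite !inE; apply/negbTE.
by apply/andP => -[/eqP->]; apply/negP.
Qed.

Section faithfulness.
Context d (T : measurableType d) (R : realType) (P : probability T R).
Context (W : 'I_5 -> {RV P >-> R}).
Hypothesis faithful : linearly_faithful W DAG1b.
Local Notation c x y := (cov_mx W x y).

(** A variable correlated with [A0] is not almost surely constant: this gives both values of [L]
    positive probability. *)
Lemma faithful_A0_L : c vA0 vL != 0.
Proof.
apply/eqP => /partial_corr_set0_eq0 e; apply: DAG1b_A0_L_connected.
by apply/(faithful.2 _ _ _ _ (finset.setI0 _) (finset.setI0 _)) => //; exact: disjoint_set1.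
Qed.

Lemma faithful_A0_Y_given_L : c vA0 vY - c vA0 vL / c vL vL * c vL vY != 0.
Proof.
apply/eqP => /partial_corr_set1_eq0 e; apply: DAG1b_A0_Y_connected.
by apply/(faithful.2 _ _ _ _ _ _) => //; exact: disjoint_set1.
Qed.

End faithfulness.
(** * Conditional densities under DAG 1b *)

Section tonelli_on.
Local Open Scope ereal_scope.
Context d1 d2 (T1 : measurableType d1) (T2 : measurableType d2) (R : realType).
Variables (m1 : {sigma_finite_measure set T1 -> \bar R})
          (m2 : {sigma_finite_measure set T2 -> \bar R}).
Variable f : T1 * T2 -> \bar R.
Hypothesis mf : measurable_fun setT f.
Hypothesis f0 : forall z, 0 <= f z.

Let restrict_ge0 C z : 0 <= (f \_ C) z.
Proof. by rewrite patchE; case: ifP. Qed.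

Let measurable_restrict_prod A B : measurable A -> measurable B ->
  measurable_fun setT (f \_ (A `*` B)).
Proof.
move=> mA mB; apply/measurable_restrict => //; first exact: measurableX.
exact: measurable_funTS.
Qed.

Lemma measurable_integral_on B : measurable B ->
  measurable_fun setT (fun x => \int[m2]_(y in B) f (x, y)).
Proof.
move=> mB.
rewrite (_ : (fun x => _) = fun x => \int[m2]_y (f \_ (setT `*` B)) (x, y)).
  apply: (measurable_fun_fubini_tonelli_F (f \_ (setT `*` B))) => //.
  exact: measurable_restrict_prod.
apply/funext => x; rewrite integral_mkcond; apply: eq_integral => y _.
by rewrite !patchE in_setX in_setT.
Qed.

Lemma tonelli_on A B : measurable A -> measurable B ->
  \int[m1]_(x in A) \int[m2]_(y in B) f (x, y) =
  \int[m2]_(y in B) \int[m1]_(x in A) f (x, y).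
Proof.
move=> mA mB; transitivity (\int[m1]_x \int[m2]_y (f \_ (A `*` B)) (x, y)).
  rewrite integral_mkcond; apply: eq_integral => x _; rewrite patchE.
  case: ifPn => xA.
    rewrite integral_mkcond; apply: eq_integral => y _.
    by rewrite !patchE in_setX xA.
  by rewrite integral0_eq// => y _; rewrite patchE in_setX (negbTE xA).
rewrite fubini_tonelli//; last exact: measurable_restrict_prod.
rewrite [RHS]integral_mkcond; apply: eq_integral => y _; rewrite patchE.
case: ifPn => yB.
  rewrite [RHS]integral_mkcond; apply: eq_integral => x _.
  by rewrite !patchE in_setX yB andbT.
by rewrite integral0_eq// => x _; rewrite patchE in_setX (negbTE yB) andbF.
Qed.

End tonelli_on.

(** * Integrals of functions of a variable whose law on an event has a density *)

Section integral_density.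
Local Open Scope ereal_scope.
Context d (T : measurableType d) (R : realType) (m : {measure set T -> \bar R}).
Context d' (T' : measurableType d') (m' : {measure set T' -> \bar R}).
Variables (X : T -> T') (D : set T) (E : set T') (k : T' -> R).
Hypothesis mX : measurable_fun setT X.
Hypothesis mD : measurable D.
Hypothesis mE : measurable E.
Hypothesis mk : measurable_fun setT k.
Hypothesis k0 : forall x, (0 <= k x)%R.
Hypothesis law : forall B, measurable B ->
  m (D `&` X @^-1` B) = \int[m']_(x in E `&` B) (k x)%:E.

Import HBNNSimple.

Let integral_density_nnsfun (g : {nnsfun T' >-> R}) :
  \int[m]_(t in D) (g (X t))%:E = \int[m']_(x in E) ((g x)%:E * (k x)%:E).
Proof.
pose r : seq R := finmap.enum_fset (fset_set (range g)).
have gE x : (g x)%:E = \sum_(y <- r) y%:E * (\1_(g @^-1` [set y]) x)%:E.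
  by rewrite (fimfunE g x) fsbig_finite//= -sumEFin; apply: eq_bigr.
have mg y : measurable (g @^-1` [set y]) by exact: measurable_funPTI.
under eq_integral do rewrite gE.
have gkE x : (g x)%:E * (k x)%:E =
    \sum_(y <- r) y%:E * (\1_(g @^-1` [set y]) x)%:E * (k x)%:E.
  by rewrite gE ge0_sume_distrl// => y _; exact: nnfun_muleindic_ge0.
under [RHS]eq_integral do rewrite gkE.
rewrite ge0_integral_sum//; last 2 first.
- move=> y; apply: measurable_funTS; apply: emeasurable_funM => //.
  apply/measurable_EFinP; apply: (measurableT_comp _ mX).
  exact: measurable_indic.
- by move=> y t _; exact: nnfun_muleindic_ge0.
rewrite ge0_integral_sum//; last 2 first.
- move=> y; apply: measurable_funTS; apply: emeasurable_funM => /=.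
    by apply: emeasurable_funM => //; apply/measurable_EFinP; exact: measurable_indic.
  exact/measurable_EFinP.
- by move=> y t _; rewrite mule_ge0 ?lee_fin//; exact: nnfun_muleindic_ge0.
apply: eq_bigr => y _.
have [y0|y0] := leP 0%R y; last first.
  rewrite preimage_nnfun0// integral0_eq ?integral0_eq// => x _;
  by rewrite indic0 mule0 ?mul0e.
rewrite ge0_integralZl//; last first.
  by apply: measurable_funTS; apply/measurable_EFinP;
    apply: (measurableT_comp _ mX); exact: measurable_indic.
under [RHS]eq_integral do rewrite -muleA.
rewrite ge0_integralZl//; last 2 first.
- by apply: measurable_funTS; apply: emeasurable_funM; apply/measurable_EFinP.
- by move=> x _; rewrite mule_ge0// lee_fin.
congr (_ * _).
rewrite (_ : \int[m]_(x in D) _ = \int[m]_(x in D) (\1_(X @^-1` (g @^-1` [set y])) x)%:E)//.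
rewrite integral_indic//; last by rewrite -[_ @^-1` _]setTI; exact: mX.
rewrite setIC law// integral_mkcondr epatch_indic.
by apply: eq_integral => x _ /=; rewrite muleC.
Qed.

(** By the hypothesis [law], [k] is the density on [E] of the law of [X] under [m] restricted to
    [D]; monotone convergence extends the identity from simple functions to [h]. *)
Lemma integral_density (h : T' -> \bar R) :
  measurable_fun setT h -> (forall x, 0 <= h x) ->
  \int[m]_(t in D) h (X t) = \int[m']_(x in E) (h x * (k x)%:E).
Proof.
move=> mh h0; pose g := nnsfun_approx measurableT mh.
have gh x : (g n x)%:E @[n --> \oo] --> h x by exact: cvg_nnsfun_approx.
transitivity (limn (fun n => \int[m]_(t in D) (g n (X t))%:E)).
  rewrite -monotone_convergence//.
  - by apply: eq_integral => t _; apply/esym/cvg_lim => //; exact: gh.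
  - by move=> n; apply: measurable_funTS; apply/measurable_EFinP; exact: measurableT_comp.
  - by move=> n t _; rewrite lee_fin.
  - by move=> t _ i j ij; rewrite lee_fin; exact/lefP/nd_nnsfun_approx.
under eq_fun do rewrite integral_density_nnsfun.
rewrite -monotone_convergence//.
- apply: eq_integral => x _; apply/cvg_lim => //.
  by apply: cvgeZr => //; exact: gh.
- by move=> n; apply: measurable_funTS; apply: emeasurable_funM; exact/measurable_EFinP.
- by move=> n x _; rewrite mule_ge0// lee_fin.
- move=> x _ i j ij; rewrite lee_wpmul2r ?lee_fin//.
  exact/lefP/nd_nnsfun_approx.
Qed.

End integral_density.
Lemma measurable_fun_eqe d (T : measurableType d) (R : realType)
    (f : T -> \bar R) (y : \bar R) : measurable_fun [set: T] f ->
  measurable_fun [set: T] (fun x => f x == y).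
Proof.
move=> mf; apply: (measurable_fun_bool false).
rewrite (_ : _ @^-1` _ = [set x | f x != y]); first exact: emeasurable_neq.
by apply/seteqP; split => x /=; [move/negbT|move/negbTE].
Qed.

(** * Marginalizing the hidden variable *)

Section conditional_densities.
Local Open Scope ereal_scope.
Context (R : realType) (muU : {sigma_finite_measure set (measurableTypeR R) -> \bar R}).
Variables (fU : R -> R) (fL : bool -> R -> R -> R) (fY : R -> R -> R).
Hypothesis mfU : measurable_fun [set: R] fU.
Hypothesis mfL : forall l, measurable_fun [set: R * R] (fun z => fL l z.1 z.2).
Hypothesis mfY : measurable_fun [set: R * R] (fun z => fY z.1 z.2).
Hypothesis fU0 : forall u, (0 <= fU u)%R.
Hypothesis fL0 : forall l u a, (0 <= fL l u a)%R.
Hypothesis fY0 : forall u y, (0 <= fY u y)%R.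
Hypothesis intU : \int[muU]_u (fU u)%:E = 1.
Hypothesis sumL : forall u a, (fL true u a + fL false u a = 1)%R.
Hypothesis intY : forall u, \int[lebesgue_measure]_y (fY u y)%:E = 1.

Local Notation leb := (@lebesgue_measure R).

(** [U] and [A0] are independent roots of DAG 1b, so this is the conditional density of [(L, U)]
    given [A0 = a]. *)
Definition weight (l : bool) (a u : R) : R := fL l u a * fU u.

(** This integral and the next two are [f(l | a0)], [f(y, l | a0)] and [f(y)]. They live in the
    extended reals because [f(y)] may be infinite on a null set of [y]. *)
Definition pL (l : bool) (a : R) : \bar R := \int[muU]_u (weight l a u)%:E.

Definition pYL (l : bool) (y a : R) : \bar R :=
  \int[muU]_u (fY u y * weight l a u)%:E.

Definition pY (y : R) : \bar R := \int[muU]_u (fY u y * fU u)%:E.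

Lemma weight_ge0 l a u : (0 <= weight l a u)%R.
Proof. exact: mulr_ge0. Qed.

Lemma weight_sum a u : (weight true a u + weight false a u = fU u)%R.
Proof. by rewrite /weight -mulrDl sumL mul1r. Qed.

Lemma measurable_weight_prod l :
  measurable_fun [set: R * R] (fun z => weight l z.1 z.2).
Proof.
apply: measurable_funM.
  by apply: (measurableT_comp (mfL l) (g := fun z => (z.2, z.1))); exact: measurable_fun_pair.
exact: measurableT_comp.
Qed.

Lemma measurable_weight l a : measurable_fun [set: R] (weight l a).
Proof.
exact: (measurableT_comp (measurable_weight_prod l) (measurable_pair1 a)).
Qed.

Lemma measurable_fYr u : measurable_fun [set: R] (fY u).
Proof. exact: (measurableT_comp mfY (measurable_pair1 u)). Qed.

Lemma measurable_fYl y : measurable_fun [set: R] (fY ^~ y).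
Proof. exact: (measurableT_comp mfY (measurable_pair2 y)). Qed.

Lemma pL_ge0 l a : 0 <= pL l a.
Proof. by apply: integral_ge0 => u _; rewrite lee_fin weight_ge0. Qed.

Lemma pYL_ge0 l y a : 0 <= pYL l y a.
Proof. by apply: integral_ge0 => u _; rewrite lee_fin mulr_ge0// weight_ge0. Qed.

Lemma pY_ge0 y : 0 <= pY y.
Proof. by apply: integral_ge0 => u _; rewrite lee_fin mulr_ge0. Qed.

Lemma pL_sum a : pL true a + pL false a = 1.
Proof.
rewrite -intU -ge0_integralD//.
- by apply: eq_integral => u _; rewrite -EFinD weight_sum.
- by move=> u _; rewrite lee_fin weight_ge0.
- by apply/measurable_EFinP; exact: measurable_weight.
- by move=> u _; rewrite lee_fin weight_ge0.
- by apply/measurable_EFinP; exact: measurable_weight.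
Qed.

(** The source of part (b) of H: [Y] depends on [u] alone, and summing over [l] removes [fL], the
    only factor involving [a]. *)
Lemma pYL_sum y a : pYL true y a + pYL false y a = pY y.
Proof.
rewrite -ge0_integralD//.
- by apply: eq_integral => u _; rewrite -EFinD -mulrDr weight_sum.
- by move=> u _; rewrite lee_fin mulr_ge0// weight_ge0.
- by apply/measurable_EFinP; apply: measurable_funM;
    [exact: measurable_fYl|exact: measurable_weight].
- by move=> u _; rewrite lee_fin mulr_ge0// weight_ge0.
- by apply/measurable_EFinP; apply: measurable_funM;
    [exact: measurable_fYl|exact: measurable_weight].
Qed.

Lemma pL_fin_num l a : pL l a \is a fin_num.
Proof.
rewrite ge0_fin_numE ?pL_ge0//; apply: (@le_lt_trans _ _ 1); last by rewrite ltry.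
rewrite -(pL_sum a); case: l; [rewrite leeDl|rewrite leeDr]; rewrite ?pL_ge0//.
Qed.

Lemma pYL_le l y a : pYL l y a <= pY y.
Proof.
rewrite -(pYL_sum y a); case: l; [rewrite leeDl|rewrite leeDr]; rewrite ?pYL_ge0//.
Qed.

Lemma measurable_pL l : measurable_fun [set: R] (pL l).
Proof.
apply: (measurable_fun_fubini_tonelli_F (m2 := muU)
  (fun z : measurableTypeR R * measurableTypeR R => (weight l z.1 z.2)%:E)).
- by apply/measurable_EFinP; exact: measurable_weight_prod.
- by move=> z; rewrite lee_fin weight_ge0.
Qed.

Lemma measurable_pYL l : measurable_fun [set: R * R] (fun z => pYL l z.1 z.2).
Proof.
apply: (measurable_fun_fubini_tonelli_F (m2 := muU)
  (fun z : (measurableTypeR R * measurableTypeR R) * measurableTypeR R =>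
     (fY z.2 z.1.1 * weight l z.1.2 z.2)%:E)).
- apply/measurable_EFinP; apply: measurable_funM.
    apply: (measurableT_comp mfY (g := fun z => (z.2, z.1.1))).
    by apply: measurable_fun_pair => //; exact: measurableT_comp.
  apply: (measurableT_comp (measurable_weight_prod l) (g := fun z => (z.1.2, z.2))).
  by apply: measurable_fun_pair => //; exact: measurableT_comp.
- by move=> z; rewrite lee_fin mulr_ge0// weight_ge0.
Qed.

Lemma measurable_pYLl l a : measurable_fun [set: R] (fun y => pYL l y a).
Proof.
apply: (measurableT_comp (measurable_pYL l) (g := fun y => (y, a))).
exact: measurable_fun_pair.
Qed.

Lemma measurable_pY : measurable_fun [set: R] pY.
Proof.
apply: (measurable_fun_fubini_tonelli_F (m2 := muU)
  (fun z : measurableTypeR R * measurableTypeR R => (fY z.2 z.1 * fU z.2)%:E)).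
- apply/measurable_EFinP; apply: measurable_funM.
    apply: (measurableT_comp mfY (g := fun z => (z.2, z.1))).
    exact: measurable_fun_pair.
  exact: measurableT_comp.
- by move=> z; rewrite lee_fin mulr_ge0.
Qed.

Lemma integral_pYL l a B : measurable B ->
  \int[leb]_(y in B) pYL l y a =
  \int[muU]_u ((weight l a u)%:E * \int[leb]_(y in B) (fY u y)%:E).
Proof.
move=> mB.
rewrite (@tonelli_on _ _ _ _ _ leb muU
  (fun z : measurableTypeR R * measurableTypeR R => (fY z.2 z.1 * weight l a z.2)%:E))//.
- apply: eq_integral => u _; rewrite -ge0_integralZl//.
  + by apply: eq_integral => y _; rewrite /= -EFinM mulrC.
  + by apply: measurable_funTS; apply/measurable_EFinP; exact: measurable_fYr.
  + by move=> y _; rewrite lee_fin.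
  + by rewrite lee_fin weight_ge0.
- apply/measurable_EFinP; apply: measurable_funM.
    apply: (measurableT_comp mfY (g := fun z => (z.2, z.1))).
    exact: measurable_fun_pair.
  by apply: (measurableT_comp (measurable_weight l a)).
- by move=> z; rewrite lee_fin mulr_ge0// weight_ge0.
Qed.

Lemma integral_pYL_setT l a : \int[leb]_y pYL l y a = pL l a.
Proof.
by rewrite integral_pYL//; apply: eq_integral => u _; rewrite intY mule1.
Qed.

Lemma integral_pY : \int[leb]_y pY y = 1.
Proof.
rewrite -(pL_sum 0) -!integral_pYL_setT -ge0_integralD//.
- by apply: eq_integral => y _; rewrite pYL_sum.
- by move=> y _; exact: pYL_ge0.
- exact: (measurable_pYLl true 0).
- by move=> y _; exact: pYL_ge0.
- exact: (measurable_pYLl false 0).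
Qed.

Definition cond_L (l : bool) (a : R) : R := fine (pL l a).

(* Where [L = l] has conditional probability [0] any version will do; the one
   chosen makes [cond_Y_sum] hold everywhere rather than almost everywhere. *)
Definition cond_Y (l : bool) (y a : R) : R :=
  if pL l a == 0 then fine (pY y)
  else if pY y == +oo then 0%R else (fine (pYL l y a) / cond_L l a)%R.

Lemma cond_L_ge0 l a : (0 <= cond_L l a)%R.
Proof. by rewrite fine_ge0// pL_ge0. Qed.

Lemma cond_Y_ge0 l y a : (0 <= cond_Y l y a)%R.
Proof.
rewrite /cond_Y; case: ifP => _; first by rewrite fine_ge0// pY_ge0.
case: ifP => // _; by rewrite divr_ge0 ?cond_L_ge0// fine_ge0// pYL_ge0.
Qed.

Lemma cond_L_sum a : (cond_L true a + cond_L false a = 1)%R.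
Proof. by rewrite -fineD ?pL_fin_num// pL_sum. Qed.

Lemma measurable_cond_L l : measurable_fun [set: R] (cond_L l).
Proof. by apply: measurableT_comp => //; exact (measurable_pL l). Qed.

Lemma pYL_eq0 l y a : pL l a = 0 -> pYL l y a = 0.
Proof.
move=> L0; have mw := (measurable_EFinP _ _).2 (measurable_weight l a).
have : \int[muU]_u `|(weight l a u)%:E| = 0.
  by under eq_integral do rewrite gee0_abs ?lee_fin ?weight_ge0//.
move=> /(ae_eq_integral_abs muU measurableT mw).1 w0.
rewrite /pYL (ge0_ae_eq_integral (g := cst 0)) ?integral0//.
- by apply/measurable_EFinP; apply: measurable_funM;
    [exact: measurable_fYl|exact: measurable_weight].
- by move=> u _; rewrite lee_fin mulr_ge0// weight_ge0.
- by apply: filterS w0 => u /= /(_ I) [->] _; rewrite mulr0.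
Qed.

Lemma pY_ae_fin_num : {ae leb, forall y, pY y \is a fin_num}.
Proof.
have ipY : leb.-integrable setT pY.
  apply/integrableP; split; first exact: measurable_pY.
  under eq_integral do rewrite gee0_abs ?pY_ge0//.
  by rewrite integral_pY ltry.
by apply: filterS (integrable_ae measurableT ipY) => y; apply.
Qed.

Lemma measurable_cond_Y l : measurable_fun [set: R * R] (fun z => cond_Y l z.1 z.2).
Proof.
apply: measurable_fun_ifT.
- apply: (@measurable_fun_eqe _ _ _ (fun z : R * R => pL l z.2)).
  by apply: measurableT_comp => //; exact (measurable_pL l).
- apply: measurableT_comp => //.
  by apply: measurableT_comp => //; exact measurable_pY.
- apply: measurable_fun_ifT => //.
    apply: (@measurable_fun_eqe _ _ _ (fun z : R * R => pY z.1)).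
    by apply: measurableT_comp => //; exact measurable_pY.
  apply: measurable_funM.
    by apply: measurableT_comp => //; exact: measurable_pYL.
  under eq_fun do rewrite -powR_inv1 ?cond_L_ge0//.
  apply: (measurableT_comp (measurable_powR (-1))).
  by apply: measurableT_comp => //; exact (measurable_cond_L l).
Qed.

Lemma measurable_cond_Yl l a : measurable_fun [set: R] (fun y => cond_Y l y a).
Proof.
apply: (measurableT_comp (measurable_cond_Y l) (g := fun y => (y, a))).
exact: measurable_fun_pair.
Qed.

(** The factorization [f(y, l | a0) = f(l | a0) f(y | l, a0)] is available only for almost every
    [y], because [pY] may be infinite at some points; hence the integrated form. *)
Lemma integral_cond_Y l a B : measurable B ->
  \int[leb]_(y in B) pYL l y a =
  (cond_L l a)%:E * \int[leb]_(y in B) (cond_Y l y a)%:E.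
Proof.
move=> mB; have [L0|L0] := eqVneq (pL l a) 0.
  rewrite /cond_L L0 mul0e integral0_eq// => y _; exact: pYL_eq0.
have c0 : (cond_L l a != 0)%R.
  by apply: contra_neq L0 => c0; rewrite -(fineK (pL_fin_num l a)) -/(cond_L l a) c0.
have mc : measurable_fun B (EFin \o (fun y => cond_Y l y a)).
  by apply: measurable_funTS; apply/measurable_EFinP; exact: measurable_cond_Yl.
rewrite -ge0_integralZl//; last 2 first.
- by move=> y _; rewrite lee_fin cond_Y_ge0.
- by rewrite lee_fin cond_L_ge0.
apply: ge0_ae_eq_integral => //.
- by apply: measurable_funTS; exact: measurable_pYLl.
- exact: emeasurable_funM.
- by move=> y _; exact: pYL_ge0.
- by move=> y _; rewrite mule_ge0// lee_fin ?cond_L_ge0 ?cond_Y_ge0.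
apply: (@filterS _ _ (ae_filter_ringOfSetsType leb) _ _ _ pY_ae_fin_num) => y fy _.
rewrite /cond_Y (negbTE L0) -EFinM.
have -> : (pY y == +oo) = false by apply/negbTE; move: fy; rewrite fin_numE => /andP[].
rewrite mulrC divfK// fineK//.
by rewrite ge0_fin_numE ?pYL_ge0// (le_lt_trans (pYL_le l y a))// -ge0_fin_numE// pY_ge0.
Qed.

Lemma integral_cond_Y_setT l a : \int[leb]_y (cond_Y l y a)%:E = 1.
Proof.
(* [is_cond_density] wants total mass [1] at every point; where [pL] vanishes the default version is
   the marginal density of [Y], which has it. *)
have [L0|L0] := eqVneq (pL l a) 0.
  rewrite -integral_pY; apply: ge0_ae_eq_integral => //.
  - by apply/measurable_EFinP; exact: measurable_cond_Yl.
  - exact: measurable_pY.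
  - by move=> y _; rewrite lee_fin cond_Y_ge0.
  - by move=> y _; exact: pY_ge0.
  - by apply: (@filterS _ _ (ae_filter_ringOfSetsType leb) _ _ _ pY_ae_fin_num) => y fy _;
      rewrite /cond_Y L0 eqxx fineK.
have c0 : (cond_L l a != 0)%R.
  by apply: contra_neq L0 => c0; rewrite -(fineK (pL_fin_num l a)) -/(cond_L l a) c0.
have := integral_cond_Y l a measurableT; rewrite integral_pYL_setT.
rewrite -[X in X = _](fineK (pL_fin_num l a)) -/(cond_L l a) => e.
have := congr1 (fun z => ((cond_L l a)^-1)%:E * z) e.
by rewrite muleA -EFinM mulVf// mul1e => <-.
Qed.

Lemma cond_Y_sum y a :
  (\sum_(l : bool) cond_Y l y a * cond_L l a = fine (pY y))%R.
Proof.
have h l : (cond_Y l y a * cond_L l a =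
      if pY y == +oo%E then 0 else fine (pYL l y a))%R.
  rewrite /cond_Y; have [L0|L0] := eqVneq (pL l a) 0.
    by rewrite /cond_L L0 mulr0 pYL_eq0//=; case: ifP.
  have c0 : (cond_L l a != 0)%R.
    by apply: contra_neq L0 => c0; rewrite -(fineK (pL_fin_num l a)) -/(cond_L l a) c0.
  by case: ifP => _; rewrite ?mul0r// divfK.
(* Where [pY] is infinite both sides are [0]: the left by the choice made in [cond_Y], the right
   because [fine +oo = 0]. *)
rewrite big_bool !h; have [->|fy] := eqVneq (pY y) +oo; first by rewrite ?eqxx/= addr0.
have fl l : pYL l y a \is a fin_num.
  rewrite ge0_fin_numE ?pYL_ge0// (le_lt_trans (pYL_le l y a))//.
  by rewrite lt_neqAle fy leey.
by rewrite ?(negbTE fy)/= -fineD// pYL_sum.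
Qed.

(** * Conditional laws read off the joint density *)

Section joint_law.
Context d (T : measurableType d) (P : probability T R).
Variables (A0 L A1 Y : T -> R).
Hypothesis mA0 : measurable_fun [set: T] A0.
Hypothesis mL : measurable_fun [set: T] L.
Hypothesis mA1 : measurable_fun [set: T] A1.
Hypothesis mY : measurable_fun [set: T] Y.
Hypothesis L01 : forall t, L t = 0%R \/ L t = 1%R.
Variables (fA : R -> R) (fB : bool -> R -> R -> R).
Hypothesis mfA : measurable_fun [set: R] fA.
Hypothesis mfB : forall l, measurable_fun [set: R * R] (fun z => fB l z.1 z.2).
Hypothesis fA0 : forall a, (0 <= fA a)%R.
Hypothesis fB0 : forall l a b, (0 <= fB l a b)%R.
Hypothesis intB : forall l a, \int[leb]_b (fB l a b)%:E = 1.
Hypothesis joint : forall (l : bool) (B1 B3 B4 : set R),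
  measurable B1 -> measurable B3 -> measurable B4 ->
  P (A0 @^-1` B1 `&` L @^-1` [set l%:R] `&` A1 @^-1` B3 `&` Y @^-1` B4) =
  \int[muU]_u \int[leb]_(a in B1) \int[leb]_(b in B3) \int[leb]_(y in B4)
    (fU u * (fA a * (fL l u a * (fB l a b * fY u y))))%:E.

Let measurable_pre (X : T -> R) B : measurable_fun [set: T] X -> measurable B ->
  measurable (X @^-1` B).
Proof. by move=> mX mB; rewrite -[X in measurable X]setTI; exact: mX. Qed.

Let pB l B a : R := fine (\int[leb]_(b in B) (fB l a b)%:E).

Let measurable_fBr l a : measurable_fun [set: R] (fB l a).
Proof. exact: (measurableT_comp (mfB l) (measurable_pair1 a)). Qed.

Let pB_fin_num l B a : measurable B ->
  \int[leb]_(b in B) (fB l a b)%:E \is a fin_num.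
Proof.
move=> mB; rewrite ge0_fin_numE; last by apply: integral_ge0 => b _; rewrite lee_fin.
apply: (@le_lt_trans _ _ 1); last by rewrite ltry.
rewrite -(intB l a); apply: ge0_subset_integral => //.
- by apply/measurable_EFinP; exact: measurable_fBr.
- by move=> b _; rewrite lee_fin.
Qed.

Let pB_ge0 l B a : (0 <= pB l B a)%R.
Proof. by rewrite fine_ge0//; apply: integral_ge0 => b _; rewrite lee_fin. Qed.

Let measurable_pB l B : measurable B -> measurable_fun [set: R] (pB l B).
Proof.
move=> mB; apply: measurableT_comp => //.
apply: (@measurable_integral_on _ _ _ _ _ leb
  (fun z : measurableTypeR R * measurableTypeR R => (fB l z.1 z.2)%:E)) => //.
- by apply/measurable_EFinP; exact (mfB l).
- by move=> z; rewrite lee_fin.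
Qed.

Let measurable_pYu B : measurable B ->
  measurable_fun [set: R] (fun u => \int[leb]_(y in B) (fY u y)%:E).
Proof.
move=> mB; apply: (@measurable_integral_on _ _ _ _ _ leb
  (fun z : measurableTypeR R * measurableTypeR R => (fY z.1 z.2)%:E)) => //.
- by apply/measurable_EFinP; exact mfY.
- by move=> z; rewrite lee_fin.
Qed.

(** [u] occurs in [weight] and [fY] only, so integrating it out leaves the factor [pB] of [A1] apart
    from [pYL]: given [(L, A0)], [A1] is independent of [Y]. *)
Lemma joint_marginal (l : bool) (B1 B3 B4 : set R) :
  measurable B1 -> measurable B3 -> measurable B4 ->
  P (A0 @^-1` B1 `&` L @^-1` [set l%:R] `&` A1 @^-1` B3 `&` Y @^-1` B4) =
  \int[leb]_(a in B1) ((fA a * pB l B3 a)%:E * \int[leb]_(y in B4) pYL l y a).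
Proof.
move=> m1 m3 m4; rewrite joint//.
have mYr u : measurable_fun B4 (fun y => (fY u y)%:E).
  by apply: measurable_funTS; apply/measurable_EFinP; exact: measurable_fYr.
have mBr a : measurable_fun B3 (fun b => (fB l a b)%:E).
  by apply: measurable_funTS; apply/measurable_EFinP; exact: measurable_fBr.
have Yge0 u : 0 <= \int[leb]_(y in B4) (fY u y)%:E.
  by apply: integral_ge0 => y _; rewrite lee_fin.
have inner u a : \int[leb]_(b in B3) \int[leb]_(y in B4)
    (fU u * (fA a * (fL l u a * (fB l a b * fY u y))))%:E =
    ((fA a * pB l B3 a) * weight l a u)%:E * \int[leb]_(y in B4) (fY u y)%:E.
  transitivity (\int[leb]_(b in B3) ((fU u * fA a * fL l u a)%:E *
      (\int[leb]_(y in B4) (fY u y)%:E) * (fB l a b)%:E)).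
    apply: eq_integral => b _.
    rewrite muleAC -EFinM -ge0_integralZl//; last 3 first.
    - exact (mYr u).
    - by move=> y _; rewrite lee_fin.
    - by rewrite lee_fin !mulr_ge0.
    by apply: eq_integral => y _; rewrite -EFinM !mulrA.
  rewrite ge0_integralZl//; last 3 first.
  - exact (mBr a).
  - by move=> b _; rewrite lee_fin.
  - by rewrite mule_ge0// lee_fin !mulr_ge0.
  rewrite -(fineK (pB_fin_num l a m3)) -/(pB l B3 a).
  rewrite muleAC -EFinM; congr (_%:E * _); rewrite /weight; ring.
under eq_integral do under eq_integral do rewrite inner.
rewrite (@tonelli_on _ _ _ _ _ muU leb
  (fun z : measurableTypeR R * measurableTypeR R =>
    ((fA z.2 * pB l B3 z.2) * weight l z.2 z.1)%:E *
    \int[leb]_(y in B4) (fY z.1 y)%:E))//.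
- apply: eq_integral => a _; rewrite integral_pYL// -ge0_integralZl//.
  + by apply: eq_integral => u _; rewrite EFinM muleA.
  + by apply: emeasurable_funM;
      [apply/measurable_EFinP; exact: measurable_weight|exact: measurable_pYu].
  + by move=> u _; rewrite mule_ge0// lee_fin weight_ge0.
  + by rewrite lee_fin mulr_ge0.
- apply: emeasurable_funM.
    apply/measurable_EFinP; apply: measurable_funM; last first.
      apply: (measurableT_comp (measurable_weight_prod l) (g := fun z => (z.2, z.1))).
      exact: measurable_fun_pair.
    apply: measurable_funM; first exact: measurableT_comp.
    by apply: (measurableT_comp (measurable_pB l m3)).
  by apply: (measurableT_comp (measurable_pYu m4)).
- by move=> z; rewrite mule_ge0// lee_fin !mulr_ge0// weight_ge0.
Qed.

Lemma integral_joint (l : bool) (B1 B3 : set R) (h : R -> \bar R) :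
  measurable B1 -> measurable B3 -> measurable_fun [set: R] h ->
  (forall a, 0 <= h a) ->
  \int[P]_(t in A0 @^-1` B1 `&` L @^-1` [set l%:R] `&` A1 @^-1` B3) h (A0 t) =
  \int[leb]_(a in B1) (h a * (fA a * pB l B3 a * cond_L l a)%:E).
Proof.
move=> m1 m3 mh h0; apply: integral_density => //.
- by apply: measurableI; [apply: measurableI|]; exact: measurable_pre.
- apply: measurable_funM; last exact: measurable_cond_L.
  by apply: measurable_funM => //; exact: measurable_pB.
- by move=> a; rewrite !mulr_ge0// cond_L_ge0.
- move=> B mB.
  have := joint_marginal l (measurableI _ _ m1 mB) m3 measurableT.
  rewrite preimage_setT setIT preimage_setI.
  have -> : A0 @^-1` B1 `&` A0 @^-1` B `&` L @^-1` [set l%:R] `&` A1 @^-1` B3 =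
      A0 @^-1` B1 `&` L @^-1` [set l%:R] `&` A1 @^-1` B3 `&` A0 @^-1` B.
    by apply/seteqP; split => t /= [[[? ?] ?] ?].
  move=> e; apply: (eq_trans e); apply: eq_integral => a _.
  by rewrite integral_pYL_setT [in RHS]EFinM; congr (_ * _); rewrite fineK// pL_fin_num.
Qed.

(** The source of part (a) of H: [cond_Y] does not involve [A1] while [B3] is arbitrary, so one
    function is a version of the conditional density of [Y] both given [(L, A0, A1)] and given
    [(L, A0)]. *)
Lemma cond_Y_law1 (l : bool) (B1 B3 B4 : set R) :
  measurable B1 -> measurable B3 -> measurable B4 ->
  P (A0 @^-1` B1 `&` L @^-1` [set l%:R] `&` A1 @^-1` B3 `&` Y @^-1` B4) =
  \int[P]_(t in A0 @^-1` B1 `&` L @^-1` [set l%:R] `&` A1 @^-1` B3)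
    \int[leb]_(y in B4) (cond_Y l y (A0 t))%:E.
Proof.
move=> m1 m3 m4; rewrite joint_marginal//.
rewrite (@integral_joint l B1 B3 (fun a => \int[leb]_(y in B4) (cond_Y l y a)%:E))//.
- apply: eq_integral => a _; rewrite integral_cond_Y//.
  by rewrite [in RHS]muleC !EFinM !muleA.
- apply: (@measurable_integral_on _ _ _ _ _ leb
    (fun z : measurableTypeR R * measurableTypeR R => (cond_Y l z.2 z.1)%:E)) => //.
  + apply/measurable_EFinP.
    apply: (measurableT_comp (measurable_cond_Y l) (g := fun z => (z.2, z.1))).
    exact: measurable_fun_pair.
  + by move=> z; rewrite lee_fin cond_Y_ge0.
- by move=> a; apply: integral_ge0 => y _; rewrite lee_fin cond_Y_ge0.
Qed.

Lemma preimage_L (B : set R) : L @^-1` B =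
  \big[setU/set0]_(l : bool) (if (l%:R : R) \in B then L @^-1` [set l%:R] else set0).
Proof.
rewrite big_bool; apply/seteqP; split => t /=.
  by case: (L01 t) => Lt BL; rewrite Lt in BL; [right|left]; rewrite mem_set.
by case; case: ifPn => //; rewrite inE /preimage /= => hB e; exact (eq_ind_r B hB e).
Qed.

(** Reduces an arbitrary Borel condition on [L] to the two atoms [0] and [1]. *)
Lemma binary_split (S Q : set T) (B : set R) (h : T -> \bar R) : measurable S -> measurable Q ->
  measurable B -> measurable_fun [set: T] h -> (forall t, 0 <= h t) ->
  (forall l : bool, P (S `&` L @^-1` [set l%:R] `&` Q) =
     \int[P]_(t in S `&` L @^-1` [set l%:R]) h t) ->
  P (S `&` L @^-1` B `&` Q) = \int[P]_(t in S `&` L @^-1` B) h t.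
Proof.
move=> mS mQ mB mh h0 H.
pose E (l : bool) := if (l%:R : R) \in B then L @^-1` [set l%:R] else set0.
have mE l : measurable (E l).
  by rewrite /E; case: ifP => // _; exact: measurable_pre.
have HE l : P (S `&` E l `&` Q) = \int[P]_(t in S `&` E l) h t.
  by rewrite /E; case: ifP => _; rewrite ?H// setI0 set0I measure0 integral_set0.
have E01 : E true `&` E false = set0.
  apply/seteqP; split => // t; rewrite /E; case: ifP => _; case: ifP => _ [] // e1 e0.
  by have /eqP := oner_neq0 R; apply; exact (eq_trans (esym e1) e0).
rewrite preimage_L big_bool -/(E true) -/(E false) setIUr setIUl.
rewrite measureU ?ge0_integral_setU//.
all: try by apply: measurableI => //; apply: measurableI.
- by rewrite -!HE.
- by apply: measurable_funTS.
- apply/disj_set2P; apply/seteqP; split => // t [[_ a] [_ b]].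
  by rewrite -E01.
- by apply/seteqP; split => // t [[[_ a] _] [[_ b] _]]; rewrite -E01.
Qed.

Lemma measurable_L_eq1 : measurable_fun [set: T] (fun t => L t == 1%R).
Proof. by apply: measurable_fun_eqr. Qed.

Lemma cond_Y_law (B1 B2 B3 B4 : set R) :
  measurable B1 -> measurable B2 -> measurable B3 -> measurable B4 ->
  P (A0 @^-1` B1 `&` A1 @^-1` B3 `&` L @^-1` B2 `&` Y @^-1` B4) =
  \int[P]_(t in A0 @^-1` B1 `&` A1 @^-1` B3 `&` L @^-1` B2)
    \int[leb]_(y in B4) (cond_Y (L t == 1%R) y (A0 t))%:E.
Proof.
move=> m1 m2 m3 m4.
have mH l : measurable_fun [set: T] (fun t => \int[leb]_(y in B4) (cond_Y l y (A0 t))%:E).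
  apply: (measurableT_comp (f := fun a => \int[leb]_(y in B4) (cond_Y l y a)%:E)) => //.
  apply: (@measurable_integral_on _ _ _ _ _ leb
    (fun z : measurableTypeR R * measurableTypeR R => (cond_Y l z.2 z.1)%:E)) => //.
  + apply/measurable_EFinP.
    apply: (measurableT_comp (measurable_cond_Y l) (g := fun z => (z.2, z.1))).
    exact: measurable_fun_pair.
  + by move=> z; rewrite lee_fin cond_Y_ge0.
apply: binary_split => //.
- by apply: measurableI; exact: measurable_pre.
- exact: measurable_pre.
- rewrite (_ : (fun t => _) = fun t => if L t == 1%R
      then \int[leb]_(y in B4) (cond_Y true y (A0 t))%:E
      else \int[leb]_(y in B4) (cond_Y false y (A0 t))%:E); last first.
    by apply/funext => t; case: (L t == 1%R).
  apply: measurable_fun_ifT => //; exact: measurable_L_eq1.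
- by move=> t; apply: integral_ge0 => y _; rewrite lee_fin cond_Y_ge0.
- move=> l; rewrite (setIAC (A0 @^-1` B1)).
  apply: (eq_trans (cond_Y_law1 l m1 m3 m4)); apply: eq_integral => t.
  have l1 : ((nat_of_bool l)%:R == 1 :> R)%R = l.
    by case: (l); rewrite ?eqxx// eq_sym oner_eq0.
  by rewrite inE => -[[_ /= ->] _]; rewrite l1.
Qed.

Let joint_A0_L (l : bool) (B : set R) : measurable B ->
  P (A0 @^-1` B `&` L @^-1` [set l%:R]) =
  \int[leb]_(a in B) (cond_L l a * fA a)%:E.
Proof.
move=> mB; have := joint_marginal l mB measurableT measurableT.
rewrite !preimage_setT !setIT => ->; apply: eq_integral => a _.
by rewrite integral_pYL_setT /pB intB mulr1 -(fineK (pL_fin_num l a)) -EFinM mulrC.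
Qed.

Let law_A0 (B : set R) : measurable B ->
  P (A0 @^-1` B) = \int[leb]_(a in B) (fA a)%:E.
Proof.
move=> mB.
have -> : A0 @^-1` B = (A0 @^-1` B `&` L @^-1` [set true%:R]) `|`
   (A0 @^-1` B `&` L @^-1` [set false%:R]).
  by rewrite -setIUr -[LHS]setIT; congr setI; apply/seteqP; split => t //= _;
    case: (L01 t); [right|left].
rewrite measureU; last 3 first.
- by apply: measurableI; exact: measurable_pre.
- by apply: measurableI; exact: measurable_pre.
- apply/seteqP; split => // t /= [[_ e1] [_ e0]].
  by have /eqP := oner_neq0 R; apply; exact (eq_trans (esym e1) e0).
rewrite [X in X + _](joint_A0_L true mB) [X in _ + X](joint_A0_L false mB) -ge0_integralD//.
- by apply: eq_integral => a _; rewrite -EFinD -mulrDl cond_L_sum mul1r.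
- by move=> a _; rewrite lee_fin mulr_ge0// cond_L_ge0.
- apply: measurable_funTS; apply/measurable_EFinP; apply: measurable_funM => //.
  exact: measurable_cond_L.
- by move=> a _; rewrite lee_fin mulr_ge0// cond_L_ge0.
- apply: measurable_funTS; apply/measurable_EFinP; apply: measurable_funM => //.
  exact: measurable_cond_L.
Qed.

(** The integrand is the integral over [B2] of the conditional density of [L] for the counting
    measure on [{0, 1}], written out as in [integral_dirac01]. *)
Lemma cond_L_law (B1 B2 : set R) : measurable B1 -> measurable B2 ->
  P (A0 @^-1` B1 `&` L @^-1` B2) =
  \int[P]_(t in A0 @^-1` B1)
    ((\1_B2 (0%R : R))%:E * (cond_L false (A0 t))%:E +
     (\1_B2 (1%R : R))%:E * (cond_L true (A0 t))%:E).
Proof.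
move=> m1 m2.
have mc l : measurable_fun [set: R] (fun a => (cond_L l a)%:E).
  by apply/measurable_EFinP; exact: measurable_cond_L.
rewrite (@integral_density _ _ _ P _ _ leb A0 (A0 @^-1` B1) B1 fA _ _ _ _ _ _
  (fun a => (\1_B2 (0%R : R))%:E * (cond_L false a)%:E +
     (\1_B2 (1%R : R))%:E * (cond_L true a)%:E))//; last 4 first.
- exact: measurable_pre.
- move=> B mB; rewrite -preimage_setI.
  exact (law_A0 (measurableI _ _ m1 mB)).
- by apply: emeasurable_funD; apply: emeasurable_funM => //; exact (mc _).
- by move=> a; rewrite adde_ge0// mule_ge0// lee_fin cond_L_ge0.
have -> : \int[leb]_(a in B1) (((\1_B2 (0%R : R))%:E * (cond_L false a)%:E +
     (\1_B2 (1%R : R))%:E * (cond_L true a)%:E) * (fA a)%:E) =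
  (\1_B2 (0%R : R))%:E * \int[leb]_(a in B1) (cond_L false a * fA a)%:E +
  (\1_B2 (1%R : R))%:E * \int[leb]_(a in B1) (cond_L true a * fA a)%:E.
  have mcf l : measurable_fun B1 (fun a => (cond_L l a * fA a)%:E).
    apply: measurable_funTS; apply/measurable_EFinP; apply: measurable_funM => //.
    exact: measurable_cond_L.
  have cf0 l a : 0 <= (cond_L l a * fA a)%:E by rewrite lee_fin mulr_ge0// cond_L_ge0.
  have Z l (c : R) : (0 <= c)%R -> c%:E * \int[leb]_(a in B1) (cond_L l a * fA a)%:E =
      \int[leb]_(a in B1) (c * (cond_L l a * fA a))%:E.
    move=> c0; rewrite -ge0_integralZl//; exact (mcf l).
  have mZ l (c : R) : measurable_fun B1 (fun a => (c * (cond_L l a * fA a))%:E).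
    apply: measurable_funTS; apply/measurable_EFinP; apply: measurable_funM => //.
    by apply: measurable_funM => //; exact: measurable_cond_L.
  have distr (p q r s t : R) : (p%:E * q%:E + r%:E * s%:E) * t%:E =
      (p * (q * t))%:E + (r * (s * t))%:E.
    by rewrite -!EFinM -!EFinD; congr EFin; ring.
  rewrite !Z ?indicE// -ge0_integralD//.
  - by apply: eq_integral => a _; exact (distr _ _ _ _ _).
  - by move=> a _; rewrite lee_fin !mulr_ge0// cond_L_ge0.
  - exact (mZ _ _).
  - by move=> a _; rewrite lee_fin !mulr_ge0// cond_L_ge0.
  - exact (mZ _ _).
rewrite -!joint_A0_L//.
have mS l : measurable (A0 @^-1` B1 `&` L @^-1` [set (nat_of_bool l)%:R]).
  by apply: measurableI; exact: measurable_pre.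
rewrite preimage_L big_bool setIUr measureU.
- by rewrite addeC !indicE /=; do 2 case: ifP => _; rewrite ?mul1e ?mul0e ?setI0 ?measure0.
- by case: ifP => _; rewrite ?setI0.
- by case: ifP => _; rewrite ?setI0.
- apply/seteqP; split => // t; case: ifP => _; case: ifP => _;
    rewrite ?setI0 ?set0I// => -[[_ e1] [_ e0]].
  by have /eqP := oner_neq0 R; apply; exact (eq_trans (esym e1) e0).
Qed.

End joint_law.

End conditional_densities.

(** * Points of [R^5] and integration over [{0, 1}] *)

Section five_tuples.
Context (R : realType).

Definition tup (u a l b y : R) : 5.-tuple R := [tuple u; a; l; b; y].

Lemma ord5_ind (Q : 'I_5 -> Prop) :
  Q vU -> Q vA0 -> Q vL -> Q vA1 -> Q vY -> forall i, Q i.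
Proof.
move=> q0 q1 q2 q3 q4 [[|[|[|[|[|//]]]]] i].
- by rewrite (_ : Ordinal i = vU)//; exact: val_inj.
- by rewrite (_ : Ordinal i = vA0)//; exact: val_inj.
- by rewrite (_ : Ordinal i = vL)//; exact: val_inj.
- by rewrite (_ : Ordinal i = vA1)//; exact: val_inj.
- by rewrite (_ : Ordinal i = vY)//; exact: val_inj.
Qed.

Lemma measurable_tup d (T : measurableType d) (f0 f1 f2 f3 f4 : T -> R) :
  measurable_fun [set: T] f0 -> measurable_fun [set: T] f1 ->
  measurable_fun [set: T] f2 -> measurable_fun [set: T] f3 ->
  measurable_fun [set: T] f4 ->
  measurable_fun [set: T] (fun x => tup (f0 x) (f1 x) (f2 x) (f3 x) (f4 x)).
Proof. by move=> *; apply/measurable_fun_tnthP; apply: ord5_ind. Qed.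

Lemma tnth_upd n (w : n.-tuple R) v x i :
  tnth (upd w v x) i = if i == v then x else tnth w i.
Proof. by rewrite tnth_mktuple. Qed.

Lemma prod_ord5 (F : 'I_5 -> R) :
  \prod_(v < 5) F v = F vU * (F vA0 * (F vL * (F vA1 * F vY))).
Proof.
rewrite !big_ord_recl big_ord0 mulr1.
by congr (F _ * (F _ * (F _ * (F _ * F _)))); exact: val_inj.
Qed.

Lemma enum_ord5 : enum 'I_5 = [:: vU; vA0; vL; vA1; vY].
Proof. by apply: (inj_map val_inj); rewrite val_enum_ord. Qed.

Lemma box_integral5 (mu : 'I_5 -> {measure set (measurableTypeR R) -> \bar R})
    (B : 'I_5 -> set R) (f : 5.-tuple R -> \bar R) :
  box_integral mu B f =
  (\int[mu vU]_(u in B vU) \int[mu vA0]_(a in B vA0) \int[mu vL]_(l in B vL)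
    \int[mu vA1]_(b in B vA1) \int[mu vY]_(y in B vY) f (tup u a l b y))%E.
Proof.
rewrite /box_integral enum_ord5 /=.
apply: eq_integral => u _; apply: eq_integral => a _; apply: eq_integral => l _.
apply: eq_integral => b _; apply: eq_integral => y _; congr f.
by apply: eq_from_tnth; apply: ord5_ind; rewrite !tnth_upd.
Qed.

Local Notation dirac01 :=
  (measure_add (@dirac _ (measurableTypeR R) 0 R) (@dirac _ (measurableTypeR R) 1 R)).

Lemma integral_dirac01 (B : set R) (f : R -> \bar R) : measurable B ->
  measurable_fun [set: R] f -> (forall x, 0 <= f x)%E ->
  (\int[dirac01]_(x in B) f x =
   (\1_B (0 : R))%:E * f 0%R + (\1_B (1 : R))%:E * f 1%R)%E.
Proof.
move=> mB mf f0; rewrite ge0_integral_measure_add//; last exact: measurable_funTS.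
by rewrite !integral_dirac//; apply: measurable_funTS.
Qed.

(** Every function is measurable on a singleton, so this applies directly to an inner iterated
    integral. *)
Lemma integral_dirac01_set1 (l : bool) (f : R -> \bar R) : (forall x, 0 <= f x)%E ->
  (\int[dirac01]_(x in [set l%:R]) f x
    = f l%:R)%E.
Proof.
move=> f0; rewrite ge0_integral_measure_add//; last exact: measurable_fun_set1.
rewrite !integral_dirac; try exact: measurable_fun_set1; try by [].
rewrite !diracE; case: l => /=.
  rewrite (memNset (u := 0)) ?mul0e ?add0e; last by move=> /esym/eqP; rewrite oner_eq0.
  by rewrite mem_set// mul1e.
rewrite (memNset (u := 1)) ?mul0e ?adde0; last by move=> /eqP; rewrite oner_eq0.
by rewrite mem_set// mul1e.
Qed.

End five_tuples.

(** * The hypothesis H under a factorization along DAG 1b *)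

Section true_null.
Context (R : realType) d (T : measurableType d) (P : probability T R).
Context (W : 'I_5 -> {RV P >-> R}).
Context (muU : {sigma_finite_measure set (measurableTypeR R) -> \bar R}).
Hypothesis L01 : forall t, W vL t = 0 \/ W vL t = 1.
Local Notation dirac01 :=
  (measure_add (@dirac _ (measurableTypeR R) 0 R) (@dirac _ (measurableTypeR R) 1 R)).
Local Notation mu := (reference_measure muU).

Variable p : 'I_5 -> 5.-tuple R -> R.
Hypothesis p_cond : forall v, is_cond_density W mu v (parents DAG1b v) (p v).
Hypothesis p_joint : is_joint_density W mu (fun w => \prod_(v < 5) p v w).

(** A conditional density reads only its own coordinate and those of the parents, so the remaining
    slots may be filled with [0]. *)
Let fU u := p vU (tup u 0 0 0 0).
Let fA a := p vA0 (tup 0 a 0 0 0).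
Let fL (l : bool) u a := p vL (tup u a l%:R 0 0).
Let fB (l : bool) a b := p vA1 (tup 0 a l%:R b 0).
Let fY u y := p vY (tup u 0 0 0 y).

Let mp v : measurable_fun setT (p v). Proof. by case: (p_cond v). Qed.
Let p0 v w : 0 <= p v w. Proof. by case: (p_cond v) => _ + _ _ _; apply. Qed.
Let p_dep v w w' : (forall u, u \in (v |: parents DAG1b v)%SET -> tnth w u = tnth w' u) ->
  p v w = p v w'.
Proof. by case: (p_cond v) => _ _ + _ _; apply. Qed.
Let p_int v w : (\int[mu v]_x (p v (upd w v x))%:E = 1)%E.
Proof. by case: (p_cond v) => _ _ _ + _; apply. Qed.

Let pUE u a l b y : p vU (tup u a l b y) = fU u.
Proof. by apply: p_dep; apply: ord5_ind; rewrite !inE. Qed.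
Let pAE u a l b y : p vA0 (tup u a l b y) = fA a.
Proof. by apply: p_dep; apply: ord5_ind; rewrite !inE. Qed.
Let pLE u a (l : bool) b y : p vL (tup u a l%:R b y) = fL l u a.
Proof. by apply: p_dep; apply: ord5_ind; rewrite !inE. Qed.
Let pBE u a (l : bool) b y : p vA1 (tup u a l%:R b y) = fB l a b.
Proof. by apply: p_dep; apply: ord5_ind; rewrite !inE. Qed.
Let pYE u a l b y : p vY (tup u a l b y) = fY u y.
Proof. by apply: p_dep; apply: ord5_ind; rewrite !inE. Qed.

Let mfU : measurable_fun [set: R] fU.
Proof. by apply: (measurableT_comp (mp vU)); exact: measurable_tup. Qed.
Let mfA : measurable_fun [set: R] fA.
Proof. by apply: (measurableT_comp (mp vA0)); exact: measurable_tup. Qed.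
Let mfL l : measurable_fun [set: R * R] (fun z => fL l z.1 z.2).
Proof. by apply: (measurableT_comp (mp vL)); exact: measurable_tup. Qed.
Let mfB l : measurable_fun [set: R * R] (fun z => fB l z.1 z.2).
Proof. by apply: (measurableT_comp (mp vA1)); exact: measurable_tup. Qed.
Let mfY : measurable_fun [set: R * R] (fun z => fY z.1 z.2).
Proof. by apply: (measurableT_comp (mp vY)); exact: measurable_tup. Qed.

Let updE v (u a l b y x : R) : upd (tup u a l b y) v x =
  tup (if vU == v then x else u) (if vA0 == v then x else a)
      (if vL == v then x else l) (if vA1 == v then x else b)
      (if vY == v then x else y).
Proof. by apply: eq_from_tnth; apply: ord5_ind; rewrite tnth_upd. Qed.

Let intU : (\int[muU]_u (fU u)%:E = 1)%E.
Proof.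
rewrite -(p_int vU (tup 0 0 0 0 0)); apply: eq_integral => x _.
by rewrite updE /= pUE.
Qed.
Let intB l a : (\int[lebesgue_measure]_b (fB l a b)%:E = 1)%E.
Proof.
rewrite -(p_int vA1 (tup 0 a l%:R 0 0)); apply: eq_integral => x _.
by rewrite updE /= pBE.
Qed.
Let intY u : (\int[lebesgue_measure]_y (fY u y)%:E = 1)%E.
Proof.
rewrite -(p_int vY (tup u 0 0 0 0)); apply: eq_integral => x _.
by rewrite updE /= pYE.
Qed.
Let sumL u a : fL true u a + fL false u a = 1.
Proof.
have := p_int vL (tup u a 0 0 0).
rewrite (_ : mu vL = dirac01)//.
under eq_integral do rewrite updE /=.
rewrite integral_dirac01//; last first.
- by move=> x; rewrite lee_fin.
- apply/measurable_EFinP; apply: (measurableT_comp (mp vL)); exact: measurable_tup.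
rewrite !indicE !in_setT !mul1e -EFinD => -[].
by rewrite addrC.
Qed.

Let joint (l : bool) (B1 B3 B4 : set R) :
  measurable B1 -> measurable B3 -> measurable B4 ->
  P (W vA0 @^-1` B1 `&` W vL @^-1` [set l%:R] `&` W vA1 @^-1` B3 `&` W vY @^-1` B4) =
  (\int[muU]_u \int[lebesgue_measure]_(a in B1) \int[lebesgue_measure]_(b in B3)
    \int[lebesgue_measure]_(y in B4)
    (fU u * (fA a * (fL l u a * (fB l a b * fY u y))))%:E)%E.
Proof.
move=> m1 m3 m4; case: p_joint => _ _ J.
pose B (v : 'I_5) := nth setT [:: setT; B1; [set l%:R]; B3; B4] v.
have mB v : measurable (B v).
  by move: v; apply: ord5_ind; [exact: measurableT| |exact: measurable_set1| |].
have := J B mB; rewrite box_integral5.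
rewrite (_ : \bigcap_(v in _) _ = W vA0 @^-1` B1 `&` W vL @^-1` [set l%:R] `&`
    W vA1 @^-1` B3 `&` W vY @^-1` B4); last first.
  apply/seteqP; split => t.
    by move=> h; split; [split; [split|]|]; [exact: (h vA0 I)|exact: (h vL I)|
      exact: (h vA1 I)|exact: (h vY I)].
  by move=> [[[h1 h2] h3] h4] v _; move: v; apply: ord5_ind.
move=> ->; apply: eq_integral => u _; apply: eq_integral => a _.
rewrite (_ : mu vL = dirac01)//.
rewrite (_ : B vL = [set l%:R])// integral_dirac01_set1.
  apply: eq_integral => b _; apply: eq_integral => y _ /=; congr EFin.
  by rewrite prod_ord5 pUE pAE pLE pBE pYE.
move=> x; apply: integral_ge0 => b _; apply: integral_ge0 => y _.
by rewrite lee_fin; apply: prodr_ge0.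
Qed.

Let fU0 u : 0 <= fU u. Proof. exact: p0. Qed.
Let fA0 u : 0 <= fA u. Proof. exact: p0. Qed.
Let fL0 l u a : 0 <= fL l u a. Proof. exact: p0. Qed.
Let fB0 l a b : 0 <= fB l a b. Proof. exact: p0. Qed.
Let fY0 u y : 0 <= fY u y. Proof. exact: p0. Qed.

Let cY := cond_Y muU fU fL fY.
Let cL := cond_L muU fU fL.

Let mW v : measurable_fun [set: T] (W v : T -> R).
Proof. exact: measurable_funPT. Qed.

Let cY_law (B1 B2 B3 B4 : set R) :
  measurable B1 -> measurable B2 -> measurable B3 -> measurable B4 ->
  P (W vA0 @^-1` B1 `&` W vA1 @^-1` B3 `&` W vL @^-1` B2 `&` W vY @^-1` B4) =
  (\int[P]_(t in W vA0 @^-1` B1 `&` W vA1 @^-1` B3 `&` W vL @^-1` B2)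
    \int[lebesgue_measure]_(y in B4) (cY (W vL t == 1) y (W vA0 t))%:E)%E.
Proof.
move=> m1 m2 m3 m4; have joint' := joint.
have w0 := mW vA0; have w1 := mW vA1; have w2 := mW vL; have w3 := mW vY.
by eapply cond_Y_law; eassumption.
Qed.

Let cL_law (B1 B2 : set R) : measurable B1 -> measurable B2 ->
  P (W vA0 @^-1` B1 `&` W vL @^-1` B2) =
  (\int[P]_(t in W vA0 @^-1` B1)
    ((\1_B2 (0 : R))%:E * (cL false (W vA0 t))%:E +
     (\1_B2 (1 : R))%:E * (cL true (W vA0 t))%:E))%E.
Proof.
move=> m1 m2; have joint' := joint.
have w0 := mW vA0; have w1 := mW vA1; have w2 := mW vL; have w3 := mW vY.
by eapply cond_L_law; eassumption.
Qed.

Let mcY l : measurable_fun [set: R * R] (fun z => cY l z.1 z.2).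
Proof. by eapply measurable_cond_Y; eassumption. Qed.
Let mcL l : measurable_fun [set: R] (cL l).
Proof. by eapply measurable_cond_L; eassumption. Qed.
Let cY0 l y a : 0 <= cY l y a.
Proof. by apply: cond_Y_ge0. Qed.
Let cL0 l a : 0 <= cL l a.
Proof. by apply: cond_L_ge0. Qed.
Let cY_int l a : (\int[lebesgue_measure]_y (cY l y a)%:E = 1)%E.
Proof. by eapply integral_cond_Y_setT; eassumption. Qed.
Let cL_sum a : cL true a + cL false a = 1.
Proof. by eapply cond_L_sum; eassumption. Qed.
Let cY_sum y a : \sum_(l : bool) cY l y a * cL l a = fine (pY muU fU fY y).
Proof. by eapply cond_Y_sum; eassumption. Qed.

Let condY y (a0 l : R) := cY (l == 1) y a0.
Let condL (l a0 : R) := if l == 1 then cL true a0 else if l == 0 then cL false a0 else 0.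

Let condL0 l a : 0 <= condL l a.
Proof. by rewrite /condL; case: ifP => // _; case: ifP. Qed.

Let measurable_condY :
  measurable_fun setT (fun w : 5.-tuple R => condY (tnth w vY) (tnth w vA0) (tnth w vL)).
Proof.
rewrite (_ : (fun w => _) = fun w => if tnth w vL == 1
   then cY true (tnth w vY) (tnth w vA0) else cY false (tnth w vY) (tnth w vA0)); last first.
  by apply/funext => w; rewrite /condY; case: (_ == _).
have m l : measurable_fun setT (fun w : 5.-tuple R => cY l (tnth w vY) (tnth w vA0)).
  apply: (measurableT_comp (mcY l) (g := fun w : 5.-tuple R => (tnth w vY, tnth w vA0))).
  by apply: measurable_fun_pair; exact: measurable_tnth.
apply: measurable_fun_ifT => //.
by apply: measurable_fun_eqr => //; exact: measurable_tnth.
Qed.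

Let condY_cond (D : {set 'I_5}) : D = [set vL; vA0; vA1]%SET \/ D = [set vL; vA0]%SET ->
  is_cond_density W mu vY D
    (fun w => condY (tnth w vY) (tnth w vA0) (tnth w vL)).
Proof.
move=> DE; have [DL DA DY] : [/\ vL \in D, vA0 \in D & vY \notin D].
  by case: DE => ->; rewrite !inE.
split.
- exact: measurable_condY.
- by move=> w; exact: cY0.
- move=> w w' h; congr (condY _ _ _); apply: h; rewrite !inE ?DL ?DA ?orbT//.
- move=> w; rewrite (_ : mu vY = lebesgue_measure)//.
  by under eq_integral do rewrite !tnth_upd /= /condY; exact: cY_int.
- move=> B mB.
  (* [B3 = setT] removes the condition on [A1], so both conditioning sets [D] are instances of
     [cY_law]. *)
  pose B3 := if vA1 \in D then B vA1 else setT.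
  have mB3 : measurable B3 by rewrite /B3; case: ifP => _; [exact: mB|exact: measurableT].
  have E1 : \bigcap_(u in [set` D]) (W u @^-1` B u) =
      W vA0 @^-1` B vA0 `&` W vA1 @^-1` B3 `&` W vL @^-1` B vL.
    apply/seteqP; split => t.
      move=> h; split; [split|]; [exact: h| |exact: h].
      by rewrite /B3; case: ifP => // DA1; exact: h.
    move=> [[h0 h1] h2] v /= vD; rewrite /B3 in h1.
    by case: DE vD h1 => ->; rewrite !inE; move: v; apply: ord5_ind.
  have E2 : \bigcap_(u in [set` (vY |: D)%SET]) (W u @^-1` B u) =
      W vA0 @^-1` B vA0 `&` W vA1 @^-1` B3 `&` W vL @^-1` B vL `&` W vY @^-1` B vY.
    rewrite -E1; apply/seteqP; split => t.
      by move=> h; split; [move=> v vD|]; apply: h; rewrite /= !inE ?eqxx//;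
        apply/orP; right.
    by move=> [h hY] v /=; rewrite !inE => /orP[/eqP->//|]; exact: h.
  rewrite E2 E1 (cY_law (mB vA0) (mB vL) mB3 (mB vY)).
  apply: eq_integral => t _; apply: eq_integral => y _.
  by rewrite !tnth_upd /= !tnth_mktuple.
Qed.

Let condL_cond : is_cond_density W mu vL [set vA0]%SET
    (fun w => condL (tnth w vL) (tnth w vA0)).
Proof.
have m2 : measurable_fun [set: R * R] (fun z : R * R => condL z.1 z.2).
  apply: measurable_fun_ifT.
  - exact: measurable_fun_eqr.
  - exact: (measurableT_comp (mcL true)).
  - apply: measurable_fun_ifT => //; first exact: measurable_fun_eqr.
    exact: (measurableT_comp (mcL false)).
have m1 a : measurable_fun [set: R] (fun x => (condL x a)%:E).
  apply/measurable_EFinP.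
  apply: (measurableT_comp m2 (g := fun x => (x, a))).
  exact: measurable_fun_pair.
split.
- apply: (measurableT_comp m2 (g := fun w : 5.-tuple R => (tnth w vL, tnth w vA0))).
  by apply: measurable_fun_pair; exact: measurable_tnth.
- by move=> w; exact: condL0.
- by move=> w w' h; congr (condL _ _); apply: h; rewrite !inE.
- move=> w; rewrite (_ : mu vL = dirac01)//.
  under eq_integral do rewrite !tnth_upd /=.
  rewrite integral_dirac01//.
  + by rewrite !indicE !in_setT !mul1e -EFinD /condL !eqxx eq_sym oner_eq0 addrC cL_sum.
  + by move=> x; rewrite lee_fin.
- move=> B mB.
  have E1 : \bigcap_(u in [set` [set vA0]%SET]) (W u @^-1` B u) = W vA0 @^-1` B vA0.
    apply/seteqP; split => t; first by apply; rewrite /= inE.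
    by move=> h v /=; rewrite inE => /eqP->.
  have E2 : \bigcap_(u in [set` (vL |: [set vA0])%SET]) (W u @^-1` B u) =
      W vA0 @^-1` B vA0 `&` W vL @^-1` B vL.
    apply/seteqP; split => t.
      by move=> h; split; apply: h; rewrite /= !inE.
    by move=> [h0 h1] v /=; rewrite !inE => /orP[] /eqP->.
  rewrite E2 E1 (cL_law (mB vA0) (mB vL)).
  apply: eq_integral => t _; rewrite (_ : mu vL = dirac01)//.
  under [RHS]eq_integral do rewrite !tnth_upd /= !tnth_mktuple.
  rewrite (integral_dirac01 (mB vL) (m1 (W vA0 t))); last by move=> x; rewrite lee_fin.
  by rewrite /condL !eqxx eq_sym oner_eq0.
Qed.

Lemma true_null_of_densities : true_null muU W.
Proof.
(* With one function serving for both conditional densities of [Y], part (a) is an identity; in part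
   (b) both sums equal the marginal density of [Y]. *)
exists (fun y a0 l _ => condY y a0 l), condY, condL; split.
- by apply: condY_cond; left.
- by apply: condY_cond; right.
- exact: condL_cond.
split=> // y a0 a0'.
have h a : \sum_(l : bool) condY y a l%:R * condL l%:R a = fine (pY muU fU fY y).
  rewrite -(cY_sum y a); apply: eq_bigr => l _; rewrite /condY /condL.
  by case: l; rewrite ?eqxx// eq_sym oner_eq0.
by rewrite !h.
Qed.

End true_null.
(** * The null model and the likelihood *)

Section models.
Context (R : realType).
Implicit Types (tau : param R).

Definition mean tau (a0 l a1 : R) : R :=
  theta0 tau + theta1 tau * a0 + theta2 tau * l + theta3 tau * a1.

Lemma sqrt_sigma2_neq0 tau : 0 < sigma2 tau -> Num.sqrt (sigma2 tau) != 0.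
Proof. by move=> s0; rewrite gt_eqF// sqrtr_gt0. Qed.

Lemma model_YE tau y a0 l a1 : 0 < sigma2 tau ->
  model_Y tau y a0 l a1 = normal_peak (Num.sqrt (sigma2 tau)) *
    expR (- (y - mean tau a0 l a1) ^+ 2 / (sigma2 tau *+ 2)).
Proof.
move=> s0; rewrite /model_Y normal_pdfE ?sqrt_sigma2_neq0// /normal_fun.
by rewrite sqr_sqrtr// ltW.
Qed.

Definition success tau (a0 : R) : R :=
  let e := expR (gamma0 tau + gamma1 tau * a0) in e / (1 + e).

Lemma success_gt0 tau a0 : 0 < success tau a0.
Proof. by rewrite divr_gt0 ?addr_gt0 ?expR_gt0. Qed.

Lemma success_lt1 tau a0 : success tau a0 < 1.
Proof. by rewrite ltr_pdivrMr ?addr_gt0 ?expR_gt0// mul1r ltrDr. Qed.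

Lemma model_L1 tau a0 : model_L tau 1 a0 = success tau a0.
Proof. by rewrite /model_L eqxx. Qed.

Lemma model_L0 tau a0 : model_L tau 0 a0 = 1 - success tau a0.
Proof. by rewrite /model_L eq_sym oner_eq0. Qed.

Lemma model_L_le1 tau l a0 : model_L tau l a0 <= 1.
Proof.
rewrite /model_L; case: ifP => _; first by rewrite ltW// success_lt1.
by rewrite lerBlDr lerDl; exact/ltW/success_gt0.
Qed.

Lemma normal_kernel_inj (s c d : R) : 0 < s ->
  expR (- c ^+ 2 / (s *+ 2)) = expR (- d ^+ 2 / (s *+ 2)) -> c ^+ 2 = d ^+ 2.
Proof.
move=> s0 /expR_inj e; apply: oppr_inj; move: e; apply: mulIf.
by rewrite invr_eq0 mulrn_eq0/= gt_eqF.
Qed.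

Lemma null_space_theta1 tau fY' : 0 < sigma2 tau ->
  null_hypothesis (model_Y tau) fY' (model_L tau) -> theta1 tau = 0.
Proof.
move=> s0 [Ha Hb]; apply/eqP; apply: contraT => t1.
pose k := normal_peak (Num.sqrt (sigma2 tau)).
have k0 : 0 < k by rewrite normal_peak_gt0// sqrt_sigma2_neq0.
pose S a := model_Y tau (theta0 tau) a 0 0 * (1 - success tau a) +
            model_Y tau (theta0 tau) a 1 0 * success tau a.
have SE a a' : S a = S a'.
  have := Hb (theta0 tau) a a'; rewrite !big_bool -!(Ha _ _ 0) /= !mulr1n !mulr0n.
  by rewrite !model_L1 !model_L0 => E; rewrite /S addrC E addrC.
have Y0 y a l b : 0 < model_Y tau y a l b.
  by rewrite model_YE// mulr_gt0 ?expR_gt0.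
have S0 : 0 < S 0.
  by rewrite addr_gt0// mulr_gt0// ?success_gt0// subr_gt0 success_lt1.
(* When the mean is at distance at least [M] from [y], the normal density is at most [k exp(-x)],
   and [exp x >= 1 + x > x = k / S 0] puts this below [S 0]. *)
pose x := k / S 0.
have x0 : 0 < x by rewrite divr_gt0.
pose M := Num.sqrt (x * (sigma2 tau *+ 2)).
have M2 : M ^+ 2 = x * (sigma2 tau *+ 2).
  by rewrite sqr_sqrtr// mulr_ge0 ?ltW// mulrn_wgt0.
have M0 : 0 <= M by rewrite sqrtr_ge0.
have small a l : M <= `|theta1 tau * a + theta2 tau * l| ->
    model_Y tau (theta0 tau) a l 0 < S 0.
  move=> h; rewrite model_YE// -/k.
  have : expR (- (theta0 tau - mean tau a l 0) ^+ 2 / (sigma2 tau *+ 2)) <= expR (- x).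
    rewrite ler_expR mulNr lerN2 ler_pdivlMr ?mulrn_wgt0// -M2.
    rewrite (_ : theta0 tau - _ = - (theta1 tau * a + theta2 tau * l)); last first.
      by rewrite /mean mulr0; ring.
    by rewrite sqrrN -[leRHS]real_normK ?num_real// lerXn2r// nnegrE.
  move=> /(ler_wpM2l (ltW k0)) /le_lt_trans; apply.
  rewrite expRN ltr_pdivrMr ?expR_gt0//.
  rewrite mulrC -ltr_pdivrMr// -/x.
  by rewrite (lt_le_trans _ (expR_ge1Dx _))// ltrDr.
(* At this dose both shifts [theta1 a] and [theta1 a + theta2] are at least [M]. *)
pose a := (M + `|theta2 tau|) / theta1 tau.
have ta : theta1 tau * a = M + `|theta2 tau| by rewrite /a mulrC divfK.
have s1 : model_Y tau (theta0 tau) a 0 0 < S 0.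
  by apply: small; rewrite mulr0 addr0 ta ger0_norm ?addr_ge0// lerDl.
have s2 : model_Y tau (theta0 tau) a 1 0 < S 0.
  apply: small; rewrite mulr1 ta ger0_norm.
    by rewrite -addrA lerDl -lerBlDr sub0r -normrN ler_norm.
  by rewrite -addrA addr_ge0// -lerBlDr sub0r -normrN ler_norm.
have : S a < S 0.
  rewrite (_ : S 0 = S 0 * (1 - success tau a) + S 0 * success tau a); last by ring.
  apply: ltrD; rewrite ltr_pM2r// ?success_gt0// subr_gt0; exact: success_lt1.
by rewrite (SE a 0) ltxx.
Qed.

(** Once [theta1 = theta3 = 0], part (b) concerns a mixture of two fixed normal laws whose weights
    depend on [a0]: it is constant exactly when the laws coincide ([theta2 = 0]) or the weights are
    constant ([gamma1 = 0]). *)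
Lemma null_spaceP tau : null_space tau <->
  [/\ 0 < sigma2 tau, theta1 tau = 0, theta3 tau = 0
    & theta2 tau = 0 \/ gamma1 tau = 0].
Proof.
split.
  move=> [s0 [fY' H]]; have t1 := null_space_theta1 s0 H.
  move: H s0 => [Ha Hb] s0; rewrite /param_space /= in s0.
  have k0 : normal_peak (Num.sqrt (sigma2 tau)) != 0.
    by rewrite gt_eqF// normal_peak_gt0// sqrt_sigma2_neq0.
  have t3 : theta3 tau = 0.
    have := Ha (theta0 tau) 0 0 false; rewrite -(Ha _ _ 1) !model_YE// => /(mulfI k0).
    move=> /(normal_kernel_inj s0).
    rewrite /mean t1 !mul0r !addr0 !mulr0 !addr0 subrr expr0n /= mulr1 => /esym/eqP.
    by rewrite sqrf_eq0 opprD addrA subrr sub0r oppr_eq0 => /eqP.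
  split=> //.
  have [->|t2] := eqVneq (theta2 tau) 0; [by left|right].
  have := Hb (theta0 tau) 0 1; rewrite !big_bool -!(Ha _ _ 0) /= !mulr1n !mulr0n.
  rewrite !model_L1 !model_L0 !model_YE// /mean t1 t3 !mul0r !mulr0 !addr0 !mulr1.
  set k := normal_peak _; set e1 := expR _; set e0 := expR _ => E.
  have e10 : e1 != e0.
    apply/eqP => /(normal_kernel_inj s0).
    rewrite subrr expr0n /= opprD addrA subrr sub0r sqrrN => /eqP.
    by rewrite sqrf_eq0 (negbTE t2).
  have {E} : success tau 0 = success tau 1.
    have F : (e1 - e0) * (success tau 0 - success tau 1) = 0.
      apply: (mulfI k0); rewrite mulr0 -/k.
      rewrite (_ : k * _ = (k * e1 * success tau 0 + k * e0 * (1 - success tau 0)) -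
        (k * e1 * success tau 1 + k * e0 * (1 - success tau 1))); last by ring.
      by rewrite E subrr.
    by move/eqP: F; rewrite mulf_eq0 subr_eq0 (negbTE e10)/= subr_eq0 => /eqP.
  rewrite /success mulr0 addr0 mulr1.
  set g0 := expR (gamma0 tau); set g1 := expR (gamma0 tau + gamma1 tau).
  have g00 : 0 < g0 by exact: expR_gt0.
  have g10 : 0 < g1 by exact: expR_gt0.
  have n0 : 1 + g0 != 0 by rewrite gt_eqF// addr_gt0.
  have n1 : 1 + g1 != 0 by rewrite gt_eqF// addr_gt0.
  move/eqP; rewrite eqr_div// => /eqP E.
  have : g0 = g1 by lra.
  by move/expR_inj => E'; lra.
move=> [s0 t1 t3 t2g]; split => //.
exists (fun y a0 l => model_Y tau y a0 l 0); split.
  by move=> y a0 a1 l; rewrite /model_Y t3 !mul0r.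
move=> y a0 a0'; rewrite !big_bool /= !mulr1n !mulr0n !model_L1 !model_L0.
rewrite !model_YE// /mean t1 !mul0r.
case: t2g => [->|g1].
  by rewrite !mul0r; ring.
by rewrite /success g1 !mul0r.
Qed.

End models.

(** * Bounds on the two likelihoods *)

Section likelihood_gap.
Context (R : realType).
Implicit Types (tau : param R).
Local Notation obs := (R * R * R * R)%type.
Variables (n : nat) (v : nat -> obs).

Definition mean_of (h : obs -> R) : R := n%:R^-1 * \sum_(i < n) h (v i).

Lemma mean_ofD h1 h2 : mean_of (h1 \+ h2) = mean_of h1 + mean_of h2.
Proof. by rewrite /mean_of -mulrDr -big_split. Qed.

Lemma mean_ofZ k h : mean_of (fun x => k * h x) = k * mean_of h.
Proof. by rewrite /mean_of mulrCA -big_distrr. Qed.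

Lemma mean_of_le h1 h2 : (forall x, h1 x <= h2 x) -> mean_of h1 <= mean_of h2.
Proof. by move=> h; rewrite ler_wpM2l ?invr_ge0//; apply: ler_sum. Qed.

Definition sq_resid tau (x : obs) : R :=
  let: (a0, a1, l, y) := x in (y - mean tau a0 l a1) ^+ 2.

Definition loglik_L tau : R :=
  \sum_(i < n) (let: (a0, a1, l, y) := v i in ln (model_L tau l a0)).

Lemma loglik_L_le0 tau : loglik_L tau <= 0.
Proof.
apply: sumr_le0 => i _; case: (v i) => [[[a0 a1] l] y].
exact/ln_le0/model_L_le1.
Qed.

(** Gaussian log-likelihood per observation at variance [s] when the mean squared residual is
    [S]. *)
Definition loglik_Y (s S : R) : R := - (ln (pi *+ 2 : R) + ln s + S / s) / 2.

Lemma ln_normal_peak (s : R) : 0 < s ->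
  ln (normal_peak (Num.sqrt s)) = - (ln (pi *+ 2 : R) + ln s) / 2.
Proof.
move=> s0; rewrite /normal_peak sqr_sqrtr ?ltW//.
have p0 : 0 < pi *+ 2 :> R by rewrite mulrn_wgt0// pi_gt0.
rewrite -mulrnAr -powR12_sqrt; last by rewrite ltW// mulr_gt0.
rewrite lnV ?posrE ?powR_gt0 ?mulr_gt0// ln_powR lnM ?posrE//.
by field.
Qed.

Lemma loglikE tau : (0 < n)%N -> 0 < sigma2 tau ->
  loglik n v tau =
  n%:R * loglik_Y (sigma2 tau) (mean_of (sq_resid tau)) + loglik_L tau.
Proof.
move=> n0 s0; rewrite /loglik /loglik_L.
have nn : n%:R != 0 :> R by rewrite pnatr_eq0 -lt0n.
rewrite (_ : n%:R * _ = \sum_(i < n) (- (ln (pi *+ 2 : R) + ln (sigma2 tau)) / 2 -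
    sq_resid tau (v i) / (sigma2 tau *+ 2))); last first.
  rewrite sumrB sumr_const card_ord -[X in X - _]mulr_natl -mulr_suml.
  rewrite /loglik_Y /mean_of -mulr_natr; field.
  by rewrite nn gt_eqF.
rewrite -big_split; apply: eq_bigr => i _ /=.
case: (v i) => [[[a0 a1] l] y] /=.
rewrite model_YE// lnM ?posrE ?expR_gt0 ?normal_peak_gt0 ?sqrt_sigma2_neq0//.
by rewrite ln_normal_peak// expRK; congr (_ + _ + _); rewrite mulNr.
Qed.

(** The best variance for a given mean squared residual is that residual, by [ln z <= z - 1] at
    [z = r / s]; larger residuals only lower the likelihood. *)
Lemma loglik_Y_le (s S r : R) : 0 < r -> 0 < s -> r <= S ->
  loglik_Y s S <= loglik_Y r r.
Proof.
move=> r0 s0 rS; rewrite /loglik_Y ler_pM2r ?invr_gt0// lerN2.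
rewrite -!addrA lerD2l divff ?gt_eqF//.
have q0 : 0 < r / s by rewrite divr_gt0.
have : ln (1 + (r / s - 1)) <= r / s - 1 by rewrite le_ln1Dx// ltrBrDl subrr.
rewrite [1 + _]addrC subrK ln_div ?posrE// => h.
have : r / s <= S / s by rewrite ler_pM2r ?invr_gt0.
lra.
Qed.

Lemma loglik_Y_ge (s S : R) : 0 < s -> S <= s -> loglik_Y s s <= loglik_Y s S.
Proof.
move=> s0 Ss; rewrite /loglik_Y ler_pM2r ?invr_gt0// lerN2 lerD2l.
by rewrite ler_pM2r ?invr_gt0.
Qed.

(* The residuals are weighted by indicators because a sampled [l] is in [{0, 1}]
   only almost surely. *)
Lemma null_sq_resid_ge tau (alpha beta : R) :
  theta1 tau = 0 -> theta3 tau = 0 ->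
  let is0 := fun x : obs => (x.1.2 == 0)%:R : R in
  let is1 := fun x : obs => (x.1.2 == 1)%:R : R in
  let r0 := fun x => is0 x * (x.2 - alpha) in
  let r1 := fun x => is1 x * (x.2 - (alpha + beta)) in
  0 < mean_of is0 -> 0 < mean_of is1 ->
  mean_of (fun x => r0 x ^+ 2 + r1 x ^+ 2) -
    mean_of r0 ^+ 2 / mean_of is0 - mean_of r1 ^+ 2 / mean_of is1
  <= mean_of (sq_resid tau).
Proof.
move=> t1 t3 is0 is1 r0 r1 w0 w1.
pose d0 := alpha - theta0 tau.
pose d1 := alpha + beta - (theta0 tau + theta2 tau).
apply: (@le_trans _ _ (mean_of ((fun x => r0 x ^+ 2 + r1 x ^+ 2) \+
   (((fun x => (2 * d0) * r0 x) \+ (fun x => d0 ^+ 2 * is0 x)) \+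
   ((fun x => (2 * d1) * r1 x) \+ (fun x => d1 ^+ 2 * is1 x)))))).
  rewrite !mean_ofD !mean_ofZ.
  (* Here [d] is the reference mean minus the fitted mean on a stratum. The right side is least at
     [d = - b / w], which frees the bound from the null parameters. *)
  have q (d b w : R) : 0 < w -> - (b ^+ 2 / w) <= 2 * d * b + d ^+ 2 * w.
    move=> w_gt0; rewrite -subr_ge0.
    rewrite (_ : _ - _ = (d * w + b) ^+ 2 / w); last by field; rewrite gt_eqF.
    by rewrite divr_ge0 ?sqr_ge0// ltW.
  by rewrite -addrA lerD2l lerD// q.
apply: mean_of_le => -[[[a0 a1] l] y] /=; rewrite /r0 /r1 /is0 /is1 /= /mean t1 t3 !mul0r !addr0.
have [->|l0] := eqVneq l 0.
  rewrite eq_sym oner_eq0 /= /d0 /d1 !mul1r !mul0r.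
  by rewrite le_eqVlt; apply/orP; left; apply/eqP; ring.
have [->|l1] := eqVneq l 1.
  rewrite /= /d0 /d1 !mul1r !mul0r.
  by rewrite le_eqVlt; apply/orP; left; apply/eqP; ring.
by rewrite !mul0r !mulr0 expr0n /= !addr0 sqr_ge0.
Qed.

(** The bound [B] keeps the null supremum below [+oo]; otherwise both suprema could be infinite, and
    [+oo - +oo = -oo] means no rejection. *)
Lemma rejects_of_gap (c B G : R) :
  (forall tau, null_space tau -> loglik n v tau <= B) ->
  (forall tau, null_space tau ->
     exists2 tau', param_space tau' & loglik n v tau + G <= loglik n v tau') ->
  c < 2 * G -> rejects c n v.
Proof.
move=> HB HG cG; rewrite /rejects /LR_statistic.
set M1 := max_loglik n v (@param_space R); set M0 := max_loglik n v (@null_space R).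
have M0B : (M0 <= B%:E)%E.
  by apply: ub_ereal_sup => _ [tau nt <-]; rewrite lee_fin HB.
have M0G : (M0 <= M1 - G%:E)%E.
  apply: ub_ereal_sup => _ [tau nt <-]; rewrite leeBrDr// -EFinD.
  have [tau' pt h] := HG _ nt.
  apply: (@le_trans _ _ (loglik n v tau')%:E); first by rewrite lee_fin.
  by apply: ereal_sup_ubound; exists tau'.
(* One explicit null parameter keeps [M0] above [-oo]. *)
have nt : null_space (Param 0 0 0 0 1 0 0 : param R).
  by apply/null_spaceP; split=> //; left.
have M0l : ((loglik n v (Param 0 0 0 0 1 0 0))%:E <= M0)%E.
  by apply: ereal_sup_ubound; exists (Param 0 0 0 0 1 0 0).
move: M0B M0G M0l; case: M0 => [m0| |]//; case: M1 => [m1| |]//.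
- rewrite -EFinB !lee_fin => _ h _; rewrite -EFinB -EFinM lte_fin; lra.
- by move=> _ _ _; rewrite /= mulry gtr0_sg// mul1e ltry.
Qed.

End likelihood_gap.
(** * Measurability of the rejection event *)

Section continuity.
Context (R : realType) (n : nat) (v : nat -> R * R * R * R).
Implicit Types (tau : param R).

Lemma ln_model_L tau (l a0 : R) : ln (model_L tau l a0) =
  (l == 1)%:R * (gamma0 tau + gamma1 tau * a0) -
  ln (1 + expR (gamma0 tau + gamma1 tau * a0)).
Proof.
rewrite /model_L; set z := gamma0 tau + _.
have e0 : 0 < expR z by exact: expR_gt0.
have e1 : 0 < 1 + expR z by rewrite addr_gt0.
case: ifP => _; first by rewrite ln_div ?posrE// expRK mul1r.
rewrite mul0r sub0r -lnV ?posrE//; congr ln.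
by have ne := lt0r_neq0 e1; field.
Qed.

Definition loglik_term tau (x : R * R * R * R) : R :=
  let: (a0, a1, l, y) := x in
  - (ln (pi *+ 2 : R) + ln (sigma2 tau)) / 2 -
  (y - mean tau a0 l a1) ^+ 2 / (sigma2 tau *+ 2) +
  ((l == 1)%:R * (gamma0 tau + gamma1 tau * a0) -
   ln (1 + expR (gamma0 tau + gamma1 tau * a0))).

Lemma loglik_sumE tau : 0 < sigma2 tau ->
  loglik n v tau = \sum_(i < n) loglik_term tau (v i).
Proof.
move=> s0; rewrite /loglik; apply: eq_bigr => i _.
case: (v i) => [[[a0 a1] l] y] /=.
rewrite model_YE// lnM ?posrE ?expR_gt0 ?normal_peak_gt0 ?sqrt_sigma2_neq0//.
by rewrite ln_normal_peak// expRK ln_model_L; congr (_ + _ + _); rewrite mulNr.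
Qed.

Lemma continuous_sum_ord (f : nat -> R -> R) x0 :
  (forall i, {for x0, continuous (f i)}) ->
  {for x0, continuous (fun x => \sum_(i < n) f i x)}.
Proof.
move=> cf; elim: n => [|m IH].
  rewrite (_ : (fun x => _) = cst 0); first exact: cvg_cst.
  by apply/funext => x; rewrite big_ord0.
rewrite (_ : (fun x => _) = (fun x => \sum_(i < m) f i x) \+ f m).
  exact: (continuousD IH (cf m)).
by apply/funext => x; rewrite big_ord_recr.
Qed.

(** [param] is a bare record without topology. Seven functions of one real variable let one
    coordinate vary as [id] while the other six are constants. *)
Lemma continuous_loglik (t0 t1 t2 t3 s g0 g1 : R -> R) x0 : 0 < s x0 ->
  {for x0, continuous t0} -> {for x0, continuous t1} ->
  {for x0, continuous t2} -> {for x0, continuous t3} ->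
  {for x0, continuous s} ->
  {for x0, continuous g0} -> {for x0, continuous g1} ->
  {for x0, continuous (fun x => \sum_(i < n) loglik_term
     (Param (t0 x) (t1 x) (t2 x) (t3 x) (s x) (g0 x) (g1 x)) (v i))}.
Proof.
move=> s0 c0 c1 c2 c3 cs d0 d1; apply: (@continuous_sum_ord (fun i x => loglik_term
  (Param (t0 x) (t1 x) (t2 x) (t3 x) (s x) (g0 x) (g1 x)) (v i))) => i.
case: (v i) => [[[a0 a1] l] y] /=; rewrite /loglik_term /mean /=.
have cc (c : R) : {for x0, continuous (fun _ : R => c)} by exact: cvg_cst.
have cg : {for x0, continuous (fun x => g0 x + g1 x * a0)}.
  by apply: cvgD => //; apply: cvgM => //; exact: cvg_cst.
apply: continuousD.
  apply: continuousB.
    apply: continuousM => //; apply: continuousN; apply: continuousD => //.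
    by apply: continuous_comp => //; exact: continuous_ln.
  apply: continuousM.
    apply: (@continuous_comp _ _ _ _ (fun z : R => z ^+ 2)); last exact: exprn_continuous.
    apply: continuousB => //.
    by apply: continuousD; [apply: continuousD; [apply: continuousD|]|] => //; apply: continuousM.
  apply: continuousV; first by rewrite gt_eqF// mulrn_wgt0.
  rewrite (_ : (fun x => _) = s \+ s); first exact: continuousD.
  by apply/funext => x; rewrite mulr2n.
apply: continuousB; first exact: continuousM.
have cF : {for x0, continuous (fun x => 1 + expR (g0 x + g1 x * a0))}.
  apply: cvgD; first exact: cvg_cst.
  by apply: (continuous_comp cg); exact: continuous_expR.
by apply: (continuous_comp cF); apply: continuous_ln; rewrite addr_gt0// expR_gt0.
Qed.

(** The last clause preserves zero coordinates, so the equations of the null space survive; the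
    middle one, with [sigma2] itself as tolerance, keeps the rational variance positive. *)
Lemma rational_approx (f : R -> R) (c e x : R) : 0 < e ->
  {for x, continuous f} -> c < f x ->
  exists q : rat, [/\ c < f (ratr q), `|x - ratr q| < e & x = 0 -> ratr q = 0 :> R].
Proof.
move=> e0 cf cx; have [x0|x0] := eqVneq x 0.
  rewrite x0 in cx *.
  by exists 0; rewrite raddf0 subrr normr0.
have : \forall z \near x, c < f z by exact: (cvgr_gt (f x) cf).
move=> /nbhs_ballP[r /= r0 hr].
pose m := Num.min r e; have m0 : 0 < m by rewrite lt_min r0.
have xm : x - m < x + m by rewrite ltrBlDr -addrA ltrDl addr_gt0.
have [q] := rat_in_itvoo xm.
rewrite in_itv /= => /andP[h1 h2].
have d : `|x - ratr q| < m by rewrite ltr_distlC ltrBlDr; lra.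
exists q; split.
- by apply: hr; rewrite /ball /=; apply: (lt_le_trans d); rewrite ge_min lexx.
- by apply: (lt_le_trans d); rewrite ge_min lexx orbT.
- by move=> e'; rewrite e' eqxx in x0.
Qed.

End continuity.

(** * Suprema over rational parameters *)

Section countable_supremum.
Context (R : realType).

Definition rat_param (q : rat * rat * rat * rat * rat * rat * rat) : param R :=
  let: (t0, t1, t2, t3, s, g0, g1) := q in
  Param (ratr t0) (ratr t1) (ratr t2) (ratr t3) (ratr s) (ratr g0) (ratr g1).

(* [P] is unspecified on nonmeasurable sets, so rejection must be shown to be an
   event: the suprema in the test statistic are suprema over rational parameters,
   reached one coordinate at a time. *)
Definition rational_dense (Theta : set (param R)) : Prop :=
  forall n (v : nat -> R * R * R * R) tau c, Theta tau -> c < loglik n v tau ->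
  exists2 q, Theta (rat_param q) & c < loglik n v (rat_param q).

Lemma rational_approx_param n (v : nat -> R * R * R * R) tau c :
  0 < sigma2 tau -> c < loglik n v tau ->
  exists q, let tau' := rat_param q in
    [/\ 0 < sigma2 tau', c < loglik n v tau', theta1 tau = 0 -> theta1 tau' = 0,
        theta3 tau = 0 -> theta3 tau' = 0
      & (theta2 tau = 0 -> theta2 tau' = 0) /\ (gamma1 tau = 0 -> gamma1 tau' = 0)].
Proof.
move=> s0; rewrite loglik_sumE//; case: tau s0 => t0 t1 t2 t3 s g0 g1 /= s0 H.
have cc (x c0 : R) : {for x, continuous (fun _ : R => c0)} by exact: cvg_cst.
have ci (x : R) : {for x, continuous (fun z : R => z)} by exact: cvg_id.
have [q0 [{}H _ _]] := rational_approx ltr01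
  (@continuous_loglik R n v id (cst t1) (cst t2) (cst t3) (cst s) (cst g0) (cst g1) t0
    s0 (ci _) (cc _ _) (cc _ _) (cc _ _) (cc _ _) (cc _ _) (cc _ _)) H.
have [q1 [{}H _ z1]] := rational_approx ltr01
  (@continuous_loglik R n v (cst (ratr q0)) id (cst t2) (cst t3) (cst s) (cst g0) (cst g1) t1
    s0 (cc _ _) (ci _) (cc _ _) (cc _ _) (cc _ _) (cc _ _) (cc _ _)) H.
have [q2 [{}H _ z2]] := rational_approx ltr01
  (@continuous_loglik R n v (cst (ratr q0)) (cst (ratr q1)) id (cst t3) (cst s) (cst g0) (cst g1) t2
    s0 (cc _ _) (cc _ _) (ci _) (cc _ _) (cc _ _) (cc _ _) (cc _ _)) H.
have [q3 [{}H _ z3]] := rational_approx ltr01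
  (@continuous_loglik R n v (cst (ratr q0)) (cst (ratr q1)) (cst (ratr q2)) id
    (cst s) (cst g0) (cst g1) t3
    s0 (cc _ _) (cc _ _) (cc _ _) (ci _) (cc _ _) (cc _ _) (cc _ _)) H.
have [qs [{}H ds _]] := rational_approx s0
  (@continuous_loglik R n v (cst (ratr q0)) (cst (ratr q1)) (cst (ratr q2))
    (cst (ratr q3)) id (cst g0) (cst g1) s
    s0 (cc _ _) (cc _ _) (cc _ _) (cc _ _) (ci _) (cc _ _) (cc _ _)) H.
have {}s0 : 0 < ratr qs :> R by move: ds; rewrite ltr_distlC => /andP[]; lra.
have [p0 [{}H _ _]] := rational_approx ltr01
  (@continuous_loglik R n v (cst (ratr q0)) (cst (ratr q1)) (cst (ratr q2))
    (cst (ratr q3)) (cst (ratr qs)) id (cst g1) g0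
    s0 (cc _ _) (cc _ _) (cc _ _) (cc _ _) (cc _ _) (ci _) (cc _ _)) H.
have [p1 [{}H _ y1]] := rational_approx ltr01
  (@continuous_loglik R n v (cst (ratr q0)) (cst (ratr q1)) (cst (ratr q2))
    (cst (ratr q3)) (cst (ratr qs)) (cst (ratr p0)) id g1
    s0 (cc _ _) (cc _ _) (cc _ _) (cc _ _) (cc _ _) (cc _ _) (ci _)) H.
by exists (q0, q1, q2, q3, qs, p0, p1) => /=; rewrite loglik_sumE.
Qed.

Lemma param_space_rational_dense : rational_dense (@param_space R).
Proof.
move=> n v tau c s0 h; have [q [s h' _ _ _]] := rational_approx_param s0 h.
by exists q.
Qed.

Lemma null_space_rational_dense : rational_dense (@null_space R).
Proof.
move=> n v tau c /null_spaceP[s0 t1 t3 t2g] h.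
have [q [s h' z1 z3 [z2 y1]]] := rational_approx_param s0 h.
exists q => //; apply/null_spaceP; split; [by []|exact: z1|exact: z3|].
by case: t2g => [/z2|/y1]; [left|right].
Qed.

Context d (T : measurableType d) (V : nat -> T -> R * R * R * R).
Hypothesis mV : forall i, measurable_fun [set: T] (V i).

Lemma measurable_loglik n tau : 0 < sigma2 tau ->
  measurable_fun [set: T] (fun t => loglik n (fun i => V i t) tau).
Proof.
move=> s0; under eq_fun do rewrite loglik_sumE//.
apply: measurable_sum => i.
apply: (measurableT_comp (f := loglik_term tau)) => //.
rewrite (_ : loglik_term tau = fun x : R * R * R * R =>
  - (ln (pi *+ 2 : R) + ln (sigma2 tau)) / 2 -
  (x.2 - (theta0 tau + theta1 tau * x.1.1.1 + theta2 tau * x.1.2 + theta3 tau * x.1.1.2)) ^+ 2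
     * (sigma2 tau *+ 2)^-1 +
  ((if x.1.2 == 1 then 1 else 0) * (gamma0 tau + gamma1 tau * x.1.1.1) -
   ln (1 + expR (gamma0 tau + gamma1 tau * x.1.1.1)))); last first.
  apply/funext => -[[[a0 a1] l] y] /=; rewrite /loglik_term /mean.
  by case: (l == 1).
have m11 : measurable_fun setT (fun x : R * R * R * R => x.1.1.1).
  by do 2 apply: measurableT_comp => //.
have m12 : measurable_fun setT (fun x : R * R * R * R => x.1.1.2).
  by do 2 apply: measurableT_comp => //.
have m2 : measurable_fun setT (fun x : R * R * R * R => x.1.2).
  by apply: measurableT_comp => //.
have m3 : measurable_fun setT (fun x : R * R * R * R => x.2) by exact: measurable_snd.
have mg : measurable_fun setT (fun x : R * R * R * R => gamma0 tau + gamma1 tau * x.1.1.1).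
  by apply: measurable_funD => //; apply: measurable_funM.
apply: measurable_funD.
  apply: measurable_funB => //; apply: measurable_funM => //.
  apply: measurable_funX; apply: measurable_funB => //.
  apply: measurable_funD; last exact: measurable_funM.
  apply: measurable_funD; last exact: measurable_funM.
  by apply: measurable_funD => //; exact: measurable_funM.
apply: measurable_funB.
  apply: measurable_funM => //; apply: measurable_fun_ifT => //.
  exact: measurable_fun_eqr.
apply: (measurableT_comp (@measurable_ln R)); apply: measurable_funD => //.
by apply: (measurableT_comp (@measurable_expR R)).
Qed.

Lemma measurable_max_loglik n (Theta : set (param R)) :
  Theta `<=` @param_space R -> rational_dense Theta ->
  measurable_fun [set: T] (fun t => max_loglik n (fun i => V i t) Theta).
Proof.
move=> Theta_pos dense.
pose G (k : nat) (t : T) : \bar R := if unpickle k is Some q then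
  if `[< Theta (rat_param q) >] then (loglik n (fun i => V i t) (rat_param q))%:E
  else -oo%E else -oo%E.
rewrite (_ : (fun t => _) = fun t => esups (G ^~ t) 0).
  apply: measurable_fun_esups => k; rewrite /G; case: unpickle => [q|] //.
  case: asboolP => // hq; apply/measurable_EFinP.
  by apply: measurable_loglik; exact: Theta_pos.
apply/funext => t; apply/eqP; rewrite eq_le; apply/andP; split.
  apply: ub_ereal_sup => _ [tau ht <-].
  apply/lee_addgt0Pr => e e0.
  have [q hq hl] := dense n (fun i => V i t) tau (loglik n (fun i => V i t) tau - e) ht
    ltac:(by rewrite ltrBlDr ltrDl).
  rewrite -leeBlDr//; apply: (@le_trans _ _ (G (pickle q) t)).
    by rewrite /G pickleK; case: asboolP => // _; rewrite -EFinB lee_fin ltW.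
  by apply: ereal_sup_ubound; exists (pickle q).
apply: ub_ereal_sup => _ [k _ <-]; rewrite /G.
case: unpickle => [q|]; last exact: leNye.
case: asboolP => [hq|_]; last exact: leNye.
by apply: ereal_sup_ubound; exists (rat_param q).
Qed.

Lemma measurable_rejects n c :
  measurable [set t | rejects c n (fun i => V i t)].
Proof.
rewrite -[X in measurable X]setTI; apply: measurable_lte => //.
apply: emeasurable_funM => //; apply: emeasurable_funB.
- by apply: measurable_max_loglik => //; exact: param_space_rational_dense.
- apply: measurable_max_loglik; last exact: null_space_rational_dense.
  by move=> tau [].
Qed.

End countable_supremum.
(** * The population regression *)

Section inner_product.
Context d (T : measurableType d) (R : realType) (P : probability T R).
Implicit Types X Y Z : T -> R.
Local Notation L2 X := (X \in Lfun P 2%:E).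

Definition ip X Y : R := fine ('E_P[X \* Y])%E.

Lemma ipC X Y : ip X Y = ip Y X.
Proof. by rewrite /ip (_ : X \* Y = Y \* X)//; apply/funext => t /=; rewrite mulrC. Qed.

Lemma ipDl X Y Z : L2 X -> L2 Y -> L2 Z -> ip (X \+ Y) Z = ip X Z + ip Y Z.
Proof.
move=> hX hY hZ; rewrite /ip -fineD ?expectation_fin_num ?Lfun2_mul_Lfun1//.
rewrite -expectationD ?Lfun2_mul_Lfun1//; congr (fine 'E_P[_])%E.
by apply/funext => t /=; rewrite mulrDl.
Qed.

Lemma ipZl k X Y : L2 X -> L2 Y -> ip (k \o* X) Y = k * ip X Y.
Proof.
move=> hX hY; rewrite /ip.
have -> : (k \o* X) \* Y = k \o* (X \* Y) by apply/funext => t /=; rewrite mulrAC.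
by rewrite expectationZl ?Lfun2_mul_Lfun1// fineM// expectation_fin_num// Lfun2_mul_Lfun1.
Qed.

Lemma ip_ge0 X : 0 <= ip X X.
Proof. by rewrite fine_ge0//; apply: expectation_ge0 => t; exact: sqr_ge0. Qed.

Lemma ip11 : ip (cst 1) (cst 1) = 1.
Proof.
rewrite /ip (_ : _ \* _ = cst 1) ?expectation_cst//.
by apply/funext => t /=; rewrite mulr1.
Qed.

Lemma L2_cst c : L2 (cst c : T -> R).
Proof. exact: Lfun_cst. Qed.

Lemma L2D X Y : L2 X -> L2 Y -> L2 (X \+ Y).
Proof. by move=> hX hY; rewrite rpredD//= lee1n. Qed.

Lemma L2Z k X : L2 X -> L2 (k \o* X).
Proof. by move=> hX; rewrite Lfun_scale// ler1n. Qed.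

(** Degenerate Cauchy-Schwarz: for [ip Z Z = 0] the squared norm of [X + t Z] is affine in [t], and
    the chosen [t] would make it [-1]. *)
Lemma ip_eq0 X Z : L2 X -> L2 Z -> ip Z Z = 0 -> ip X Z = 0.
Proof.
move=> hX hZ Z0; apply/eqP; apply: contraT => XZ.
pose t := - (ip X X + 1) / (2 * ip X Z).
have := ip_ge0 (X \+ t \o* Z).
have hW : L2 (X \+ t \o* Z) by apply: L2D => //; exact: L2Z.
rewrite ipDl ?L2Z// ipZl// ![ip _ (X \+ _)]ipC !ipDl ?L2Z// !ipZl// Z0 [ip Z X]ipC.
rewrite (_ : _ + _ = -1) ?ler0N1//.
rewrite /t; field; exact: XZ.
Qed.

Lemma cov_ip X Y : L2 X -> L2 Y ->
  fine (covariance P X Y) = ip X Y - ip X (cst 1) * ip Y (cst 1).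
Proof.
move=> hX hY.
have fP : P setT \is a fin_num := fin_num_measure P _ measurableT.
have X1 := Lfun_subset12 fP hX; have Y1 := Lfun_subset12 fP hY.
have E1 Z : Z \* cst 1 = Z by apply/funext => t /=; rewrite mulr1.
rewrite covarianceE//; last exact: Lfun2_mul_Lfun1.
rewrite fineB ?fin_numM ?expectation_fin_num//; last exact: Lfun2_mul_Lfun1.
by rewrite fineM ?expectation_fin_num// /ip !E1.
Qed.

End inner_product.

Section population.
Context d (T : measurableType d) (R : realType) (P : probability T R).
Context (A0 L Y : T -> R).
Local Notation L2 X := (X \in Lfun P 2%:E).
Local Notation c X Y := (fine (covariance P X Y)).
Local Notation one := (cst 1 : T -> R).
Hypothesis L2_A0 : L2 A0.
Hypothesis L2_L : L2 L.
Hypothesis L2_Y : L2 Y.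
Hypothesis L01 : forall t, L t = 0 \/ L t = 1.
Hypothesis cov_A0_L : c A0 L != 0.
Hypothesis pcov : c A0 Y - c A0 L / c L L * c L Y != 0.

Definition slope : R := c L Y / c L L.
Definition intercept : R := ip P Y one - slope * ip P L one.
Definition resid (t : T) : R := Y t - (intercept + slope * L t).

Let residE (a b : R) : a = - slope -> b = - intercept ->
  resid = Y \+ (a \o* L \+ b \o* one).
Proof.
move=> -> ->; apply/funext => t; rewrite /resid; congr (_ + _) => /=.
by move: intercept slope => i s; ring.
Qed.

Lemma L2_resid : L2 resid.
Proof.
rewrite (residE erefl erefl).
by apply: L2D => //; apply: L2D; apply: L2Z => //; exact: L2_cst.
Qed.

Lemma ip_LL : ip P L L = ip P L one.
Proof.
rewrite /ip; congr (fine 'E_P[_])%E; apply/funext => t /=.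
by case: (L01 t) => ->; rewrite ?mulr1// mul0r.
Qed.

Lemma ip_residl X : L2 X ->
  ip P resid X = ip P Y X - slope * ip P L X - intercept * ip P one X.
Proof.
move=> hX; have h1 := L2_cst P (1 : R).
by rewrite (residE erefl erefl) !ipDl ?L2D ?L2Z// !ipZl// !mulNr addrA.
Qed.

(** With [p] the mean of [L], this is the squared norm of [L - p]; if it vanished, [L - p] would be
    orthogonal to [A0], and the covariance of [A0] and [L] would be zero. *)
Lemma var_L_gt0 : 0 < ip P L one * (1 - ip P L one).
Proof.
have h1 := L2_cst P (1 : R).
have c0 := cov_A0_L; rewrite cov_ip// in c0.
pose p := ip P L one; pose Z := L \+ (- p) \o* one.
have hZ : L2 Z by apply: L2D => //; exact: L2Z.
have ZX X : L2 X -> ip P X Z = ip P X L - p * ip P X one.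
  move=> hX; rewrite ipC /Z ipDl ?L2Z// ipZl// mulNr.
  by rewrite (ipC _ L X) (ipC _ one X).
have ZZ : ip P Z Z = p * (1 - p).
  rewrite ZX// /Z !ipDl ?L2Z// !ipZl// ip_LL ip11 (ipC _ one L) -/p.
  by ring.
rewrite -/p -ZZ lt_neqAle ip_ge0 andbT eq_sym; apply: contra c0 => /eqP Z0.
rewrite -/p mulrC; have := ip_eq0 L2_A0 hZ Z0.
by rewrite ZX// => /eqP.
Qed.

Lemma prob_L_gt0 : 0 < ip P L one.
Proof.
have := var_L_gt0; have : 0 <= ip P L one by rewrite -ip_LL ip_ge0.
by rewrite le_eqVlt => /orP[/eqP <-|//]; rewrite mul0r ltxx.
Qed.

Lemma prob_L_lt1 : ip P L one < 1.
Proof. by have := var_L_gt0; rewrite pmulr_rgt0 ?prob_L_gt0// subr_gt0. Qed.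

Lemma cov_LL : c L L = ip P L one * (1 - ip P L one).
Proof. by rewrite cov_ip// ip_LL; ring. Qed.

Lemma ip_resid1 : ip P resid one = 0.
Proof.
rewrite ip_residl; last exact: L2_cst.
by rewrite ip11 mulr1 /intercept subrr.
Qed.

Lemma ip_residL : ip P resid L = 0.
Proof.
rewrite ip_residl// (ipC _ one L) /intercept ip_LL.
have : slope * c L L = c L Y by rewrite /slope divfK// cov_LL gt_eqF// var_L_gt0.
rewrite [c L Y]cov_ip// cov_LL (ipC _ L Y) => h.
rewrite (_ : _ - _ = (ip P Y L - ip P L one * ip P Y one) -
  slope * (ip P L one * (1 - ip P L one))); last by ring.
by rewrite h; ring.
Qed.

(** Only [Y] has to be regressed on [(1, L)]: the partial covariance of [A0] and [Y] given [L] is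
    the scalar product of its residual with [A0] itself. *)
Lemma ip_residA0 : ip P resid A0 != 0.
Proof.
have h1 := L2_cst P (1 : R).
rewrite (_ : ip P resid A0 = c A0 Y - c A0 L / c L L * c L Y)//.
rewrite ip_residl// /intercept (ipC _ one A0) (ipC _ Y A0) (ipC _ L A0).
rewrite (_ : c A0 L / c L L * c L Y = slope * c A0 L); last first.
  by rewrite /slope; ring.
by rewrite !(cov_ip L2_A0)//; ring.
Qed.

Lemma ip_resid_improves : exists t : R,
  ip P (resid \+ t \o* A0) (resid \+ t \o* A0) < ip P resid resid.
Proof.
move: resid L2_resid ip_residA0 => r hR q0.
pose q := ip P r A0; pose a := ip P A0 A0.
have a0 : 0 <= a by exact: ip_ge0.
(* The minimizer would be [- q / a]; the denominator [a + 1] is positive at once and still gives the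
   decrease [q^2 (a + 2) / (a + 1)^2]. *)
have [t tE] : exists t : R, t = - q / (a + 1) by exists (- q / (a + 1)).
exists t.
have hX : L2 (r \+ t \o* A0) by apply: L2D => //; exact: L2Z.
have -> : ip P (r \+ t \o* A0) (r \+ t \o* A0) = ip P r r + 2 * t * q + t ^+ 2 * a.
  rewrite ipDl ?L2Z// ipZl// ![ip _ _ (r \+ _)]ipC !ipDl ?L2Z// !ipZl//.
  by rewrite (ipC _ A0 r) -/q -/a; ring.
rewrite -subr_gt0 (_ : _ - _ = q ^+ 2 * (a + 2) / (a + 1) ^+ 2); last first.
  by rewrite tE; field; rewrite gt_eqF// ltr_wpDl.
apply: divr_gt0; last by rewrite exprn_gt0// ltr_wpDl.
by apply: mulr_gt0; [rewrite exprn_even_gt0|rewrite ltr_wpDl].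
Qed.

End population.
(** * Consistency of the test *)

(** The deterministic core of the test: [w0], [w1] stand for the frequencies of the two strata,
    [b0], [b1] for their contributions to the mean residual, [v5] for the mean squared residual and
    [S] for that of the competitor. *)
Lemma separating_levels (R : realFieldType) (p vs v0 : R) :
  0 < p -> p < 1 -> 0 <= vs -> vs < v0 ->
  exists e s1 s, [/\ 0 < e, 0 < s1, s1 < s &
    forall w0 w1 b0 b1 v5 S,
      `|w0 - (1 - p)| < e -> `|w1 - p| < e -> `|b0| < e -> `|b1| < e ->
      `|v5 - v0| < e -> `|S - vs| < e ->
      [/\ 0 < w0, 0 < w1, S <= s1 & s <= v5 - b0 ^+ 2 / w0 - b1 ^+ 2 / w1]].
Proof.
move=> p0 p1 vs0 vsv0.
pose m := Num.min p (1 - p) / 2.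
have m0 : 0 < m by rewrite divr_gt0// lt_min p0 subr_gt0.
have mp : m *+ 2 <= p by rewrite -mulr_natr divfK// ge_min lexx.
have mp' : m *+ 2 <= 1 - p by rewrite -mulr_natr divfK// ge_min lexx orbT.
(* [e <= m] keeps both frequencies above [m], so each correction [b^2 / w] is at most [e]. The level
   [v0 - 3 e] absorbs two corrections and one deviation, [vs + e] one deviation, and
   [e <= (v0 - vs) / 6] leaves a gap of at least [(v0 - vs) / 3]. *)
pose e := Num.min m ((v0 - vs) / 6).
have e0 : 0 < e by rewrite lt_min m0 divr_gt0// subr_gt0.
have em : e <= m by rewrite ge_min lexx.
have ev : e <= (v0 - vs) / 6 by rewrite ge_min lexx orbT.
exists e, (vs + e), (v0 - 3 * e); split=> //; [lra|lra|].
move=> w0 w1 b0 b1 v5 S; rewrite !ltr_distlC => /andP[h1 h2] /andP[h3 h4] hb0 hb1.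
move=> /andP[h5 h6] /andP[h7 h8].
have q b w : `|b| < e -> m < w -> b ^+ 2 / w <= e.
  move=> hb hw; have w_gt0 : 0 < w by rewrite (lt_trans m0).
  rewrite ler_pdivrMr// -real_normK ?num_real// expr2 ler_pM//; first exact: ltW.
  by rewrite ltW// (lt_le_trans hb)// (le_trans em)// ltW.
have w0m : m < w0 by move: mp'; rewrite mulr2n; lra.
have w1m : m < w1 by move: mp; rewrite mulr2n; lra.
have := q _ _ hb0 w0m; have := q _ _ hb1 w1m.
by split; lra.
Qed.

Section consistency.
Context (R : realType) d (T : measurableType d) (P : probability T R).
Context (W : 'I_5 -> {RV P >-> R}).
Local Notation obs := (R * R * R * R)%type.
Context (V : nat -> {RV P >-> obs}).
Hypothesis L01 : forall t, W vL t = 0 \/ W vL t = 1.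
Hypothesis V_indep : mutually_independent V.
Hypothesis V_law : forall (i : nat) (A : set obs), measurable A ->
  P (V i @^-1` A) = P ((fun t => (W vA0 t, W vA1 t, W vL t, W vY t)) @^-1` A).
Hypothesis faithful : linearly_faithful W DAG1b.

Let A0 : T -> R := W vA0.
Let L : T -> R := W vL.
Let Y : T -> R := W vY.
Let one : T -> R := cst 1.
Let X0 (t : T) : obs := (W vA0 t, W vA1 t, W vL t, W vY t).

Let mX0 : measurable_fun [set: T] X0.
Proof. by do !apply: measurable_fun_pair. Qed.

Let X0m : {mfun T >-> obs} := mfun_Sub (mem_set mX0).

(** Population moments are scalar products in [L2]; [h] is the function of one observation that
    represents the product of [X] and [Z], which is integrable. *)
Let obeys_wlln_ip (h : obs -> R) (X Z : T -> R) :
  X \in Lfun P 2%:E -> Z \in Lfun P 2%:E ->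
  measurable_fun [set: obs] h -> (forall t, h (X0 t) = X t * Z t) ->
  obeys_wlln V h (ip P X Z).
Proof.
move=> hX hZ mh hE.
have hXZ : EFin \o h \o X0 = EFin \o (X \* Z).
  by apply/funext => t /=; rewrite hE.
have iXZ : P.-integrable setT (EFin \o h \o X0).
  by rewrite hXZ; apply/Lfun1_integrable; exact: Lfun2_mul_Lfun1.
have mEh : measurable_fun [set: obs] (EFin \o h) by exact/measurable_EFinP.
have ih : (distribution P X0m).-integrable setT (EFin \o h).
  by apply: integrable_pushforward.
have -> : ip P X Z = fine (\int[distribution P X0m]_x (h x)%:E)%E.
  rewrite /ip unlock; congr fine.
  rewrite (@integral_distribution _ _ _ _ _ P X0m (EFin \o h))//.
  by apply: eq_integral => t _; rewrite /= -hE.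
by apply: weak_law.
Qed.

Let L2W v : (W v : T -> R) \in Lfun P 2%:E. Proof. by case: faithful. Qed.
Let L2one : one \in Lfun P 2%:E. Proof. exact: L2_cst. Qed.

Let cov_A0_L : fine (covariance P A0 L) != 0.
Proof. by have := faithful_A0_L faithful; rewrite mxE. Qed.

Let pcov : fine (covariance P A0 Y) - fine (covariance P A0 L) /
  fine (covariance P L L) * fine (covariance P L Y) != 0.
Proof. by have := faithful_A0_Y_given_L faithful; rewrite !mxE. Qed.

Let alpha := intercept P L Y.
Let beta := slope P L Y.
Let r := resid P L Y.
Let p := ip P L one.

Let residE t : r t = Y t - (alpha + beta * L t). Proof. by []. Qed.

Let L2r : r \in Lfun P 2%:E. Proof. by apply: L2_resid; exact: L2W. Qed.

Lemma probability_rejects_ge (c dl : R) : 0 < dl ->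
  \forall n \near \oo,
    ((1 - dl)%:E <= P [set t | rejects c n (fun i => V i t)])%E.
Proof.
move=> dl0.
have p0 : 0 < p := prob_L_gt0 (L2W vA0) (L2W vL) L01 cov_A0_L.
have p1 : p < 1 := prob_L_lt1 (L2W vA0) (L2W vL) L01 cov_A0_L.
have rL : ip P r L = 0 := ip_residL (L2W vA0) (L2W vL) (L2W vY) L01 cov_A0_L.
have rone : ip P r one = 0 := ip_resid1 (L2W vL) (L2W vY).
have [t ht] := ip_resid_improves (L2W vA0) (L2W vL) (L2W vY) pcov.
have [e [s1 [s [e0 s10 s1s sep]]]] := separating_levels p0 p1 (ip_ge0 _ _) ht.
pose is0 := fun x : obs => (x.1.2 == 0)%:R : R.
pose is1 := fun x : obs => (x.1.2 == 1)%:R : R.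
pose r0 := fun x => is0 x * (x.2 - alpha).
pose r1 := fun x => is1 x * (x.2 - (alpha + beta)).
pose h5 := fun x => r0 x ^+ 2 + r1 x ^+ 2.
(* The competitor's residual is [r + t A0], hence the coefficient [- t] of [A0]; [g0] and [g1] are
   left free to copy those of any null law. *)
pose fit (g0 g1 : R) := Param alpha (- t) beta 0 s1 g0 g1.
pose h6 := sq_resid (fit 0 0).
have mx2 : measurable_fun setT (fun x : obs => x.1.2) by exact: measurableT_comp.
have mx3 : measurable_fun setT (fun x : obs => x.2) by exact: measurable_snd.
have mind (a : R) : measurable_fun setT (fun x : obs => (x.1.2 == a)%:R : R).
  rewrite (_ : (fun x => _) = fun x : obs => if x.1.2 == a then 1 else 0 : R).
    apply: measurable_fun_ifT => //; exact: measurable_fun_eqr.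
  by apply/funext => x; case: (x.1.2 == a).
have mr0 : measurable_fun setT r0.
  by apply: measurable_funM; [exact: mind|exact: measurable_funB].
have mr1 : measurable_fun setT r1.
  by apply: measurable_funM; [exact: mind|exact: measurable_funB].
have mh5 : measurable_fun setT h5.
  by apply: measurable_funD; exact: measurable_funX.
have mh6 : measurable_fun setT h6.
  rewrite (_ : h6 = fun x : obs => (x.2 - (alpha + - t * x.1.1.1 + beta * x.1.2)) ^+ 2).
    apply: measurable_funX; apply: measurable_funB => //.
    apply: measurable_funD; last exact: measurable_funM.
    apply: measurable_funD => //; apply: measurable_funM => //.
    by do 2 apply: measurableT_comp => //.
  by apply/funext => -[[[a0 a1] l] y]; rewrite /h6 /sq_resid /mean /= mul0r addr0.
have L10 : (1 == 0 :> R) = false by rewrite oner_eq0.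
have L01' : (0 == 1 :> R) = false by rewrite eq_sym oner_eq0.
have [k kE] : exists k : R, k = - 1 by exists (- 1).
(* The indicator of [L = 0] as a linear combination, so that its scalar products follow by
   linearity. *)
pose M : T -> R := one \+ k \o* L.
have ME z : M z = 1 - L z by rewrite /M /= kE mulrN1.
have L2M : M \in Lfun P 2%:E by apply: L2D; [exact: L2one|apply: L2Z; exact: (L2W vL)].
have ip0 X : X \in Lfun P 2%:E -> ip P X M = ip P X one - ip P X L.
  move=> hX; have hL := L2W vL; have h1 := L2one.
  by rewrite ipC /M ipDl ?L2Z// ipZl// kE mulN1r (ipC _ one) (ipC _ L).
have W0 : obeys_wlln V is0 (1 - p).
  have -> : 1 - p = ip P one M by rewrite ip0// ip11 (ipC _ one).
  apply: (obeys_wlln_ip L2one L2M (mind 0)) => z; rewrite ME /is0 /X0 /= mul1r /L.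
  by case: (L01 z) => ->; rewrite ?eqxx ?L10 ?subr0 ?subrr.
have W1 : obeys_wlln V is1 p.
  apply: (obeys_wlln_ip (L2W vL) L2one (mind 1)) => z; rewrite /is1 /X0 /= mulr1 /L.
  by case: (L01 z) => ->; rewrite ?eqxx ?L01'.
have V0 : obeys_wlln V r0 0.
  have -> : 0 = ip P r M.
    by rewrite ip0// rone rL subrr.
  apply: (obeys_wlln_ip L2r L2M mr0) => z; rewrite residE ME /r0 /is0 /X0 /= /L /Y.
  by case: (L01 z) => ->; rewrite ?eqxx ?L10 /=; ring.
have V1 : obeys_wlln V r1 0.
  rewrite -rL.
  apply: (obeys_wlln_ip L2r (L2W vL) mr1) => z; rewrite residE /r1 /is1 /X0 /= /L /Y.
  by case: (L01 z) => ->; rewrite ?eqxx ?L01' /=; ring.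
have V5 : obeys_wlln V h5 (ip P r r).
  apply: (obeys_wlln_ip L2r L2r mh5) => z; rewrite residE /h5 /r0 /r1 /is0 /is1 /X0 /= /L /Y.
  by case: (L01 z) => ->; rewrite ?eqxx ?L01' ?L10 /=; ring.
have V6 : obeys_wlln V h6 (ip P (r \+ t \o* A0) (r \+ t \o* A0)).
  have hX : r \+ t \o* A0 \in Lfun P 2%:E by apply: L2D => //; apply: L2Z; exact: (L2W vA0).
  apply: (obeys_wlln_ip hX hX mh6) => z; rewrite /h6 /sq_resid /mean /X0 /=.
  by rewrite residE /L /Y /A0; ring.
(* Six sample means are controlled, each with failure probability at most [dl / 6]. *)
have dl6 : 0 < dl / 6 by rewrite divr_gt0.
pose D0 n := deviation V n is0 (1 - p) e; pose D1 n := deviation V n is1 p e.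
pose D2 n := deviation V n r0 0 e; pose D3 n := deviation V n r1 0 e.
pose D4 n := deviation V n h5 (ip P r r) e.
pose D5 n := deviation V n h6 (ip P (r \+ t \o* A0) (r \+ t \o* A0)) e.
have lnpos : 0 < ln s - ln s1.
  by rewrite subr_gt0 ltr_ln ?posrE// (lt_trans s10).
near=> n.
have n0 : (0 < n)%N by near: n; exact: nbhs_infty_gt.
(* The right side is twice the log-likelihood gap; it exceeds any fixed [c] for large [n]. *)
have hn : c < n%:R * (ln s - ln s1).
  rewrite -ltr_pdivrMr//; near: n; exact: nbhs_infty_gtr.
have m0 : measurable (D0 n) := measurable_deviation V n _ _ (mind 0).
have m1 : measurable (D1 n) := measurable_deviation V n _ _ (mind 1).
have m2 : measurable (D2 n) := measurable_deviation V n _ _ mr0.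
have m3 : measurable (D3 n) := measurable_deviation V n _ _ mr1.
have m4 : measurable (D4 n) := measurable_deviation V n _ _ mh5.
have m5 : measurable (D5 n) := measurable_deviation V n _ _ mh6.
pose D := D0 n `|` (D1 n `|` (D2 n `|` (D3 n `|` (D4 n `|` D5 n)))).
have mD : measurable D by do 5 (apply: measurableU => //).
have PD : (P D <= dl%:E)%E.
  have d0 : (P (D0 n) <= (dl / 6)%:E)%E by near: n; exact: W0.2.
  have d1 : (P (D1 n) <= (dl / 6)%:E)%E by near: n; exact: W1.2.
  have d2 : (P (D2 n) <= (dl / 6)%:E)%E by near: n; exact: V0.2.
  have d3 : (P (D3 n) <= (dl / 6)%:E)%E by near: n; exact: V1.2.
  have d4 : (P (D4 n) <= (dl / 6)%:E)%E by near: n; exact: V5.2.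
  have d5 : (P (D5 n) <= (dl / 6)%:E)%E by near: n; exact: V6.2.
  rewrite (_ : dl = dl / 6 + (dl / 6 + (dl / 6 + (dl / 6 + (dl / 6 + dl / 6))))); last by field.
  rewrite !EFinD.
  do 4 (apply: (le_trans (measureU2 _ _ _)) => //;
    [by do 4 (try apply: measurableU => //)|apply: leeD => //]).
  by apply: (le_trans (measureU2 _ _ _)) => //; apply: leeD.
have sub : ~` D `<=` [set t' | rejects c n (fun i => V i t')].
  move=> z /= hz.
  have good : forall h m, ~ deviation V n h m e z -> `|mean_of n (fun i => V i z) h - m| < e.
    by move=> h m; rewrite /deviation /= => /negP; rewrite -ltNge.
  move: hz; rewrite /D => /not_orP[/good g0] /not_orP[/good g1] /not_orP[/good g2].
  move=> /not_orP[/good g3] /not_orP[/good g4 /good g5].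
  rewrite subr0 in g2; rewrite subr0 in g3.
  have [w0 w1 hS hs] := sep _ _ _ _ _ _ g0 g1 g2 g3 g4 g5.
  have s0 : 0 < s by rewrite (lt_trans s10).
  have null_le tau : null_space tau -> loglik n (fun i => V i z) tau <=
      n%:R * loglik_Y s s + loglik_L n (fun i => V i z) tau.
    move=> /null_spaceP[st t1 t3 _]; rewrite loglikE// lerD2r ler_wpM2l//.
    apply: loglik_Y_le => //; apply: (le_trans hs).
    exact: null_sq_resid_ge.
  (* The bound [B] comes from dropping [loglik_L <= 0]; the gap is free of [gamma0] and [gamma1]
     because both laws share them. *)
  apply: (@rejects_of_gap R n _ c (n%:R * loglik_Y s s) (n%:R * (loglik_Y s1 s1 - loglik_Y s s))).
  - move=> tau nt; apply: (le_trans (null_le _ nt)).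
    by rewrite gerDl loglik_L_le0.
  - move=> tau nt; exists (fit (gamma0 tau) (gamma1 tau)) => //.
    rewrite [leRHS]loglikE//.
    have : loglik_Y s1 s1 <= loglik_Y s1 (mean_of n (fun i => V i z) h6) by exact: loglik_Y_ge.
    move=> /(ler_wpM2l (ler0n R n)) h.
    have := null_le _ nt; rewrite mulrBr => h'.
    rewrite -[leRHS]/(n%:R * loglik_Y s1 (mean_of n (fun i => V i z) h6) +
      loglik_L n (fun i => V i z) tau).
    apply: (le_trans (lerD h' (lexx _))); rewrite addrC addrA subrK.
    by rewrite lerD2r.
  - apply: (lt_le_trans hn); rewrite le_eqVlt; apply/orP; left; apply/eqP.
    by rewrite /loglik_Y !divff ?gt_eqF//; field.
apply: (@le_trans _ _ (P (~` D))).
  rewrite probability_setC// EFinB leeB//.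
apply: le_measure; rewrite ?inE//; first exact: measurableC.
apply: measurable_rejects => i; exact: measurable_funPT.
Unshelve. all: by end_near. Qed.

End consistency.

(** The critical value [c] is an arbitrary constant, so the second claim covers the test at every
    fixed level. *)
Theorem theorem2 (R : realType) (d : measure_display) (T : measurableType d)
    (P : probability T R)
    (W : 'I_5 -> {RV P >-> R})
    (hL : forall t, W vL t = 0 \/ W vL t = 1)
    (V : nat -> {RV P >-> (R * R * R * R)%type})
    (hV_indep : mutually_independent V)
    (hV_law : forall (i : nat) (A : set (R * R * R * R)), measurable A ->
       P (V i @^-1` A) =
       P ((fun t => (W vA0 t, W vA1 t, W vL t, W vY t)) @^-1` A))
    (muU : {sigma_finite_measure set (measurableTypeR R) -> \bar R})
    (hDAG : factors_along W (reference_measure muU) DAG1b)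
    (hfaith : linearly_faithful W DAG1b) :
  true_null muU W /\
  (forall c : R,
     P [set t | rejects c n (fun i => V i t)] @[n --> \oo] --> 1%E).
Proof.
split.
  by have [p [p_cond p_joint]] := hDAG; exact: true_null_of_densities p_cond p_joint.
move=> c.
pose S n := [set t | rejects c n (fun i => V i t)].
have SE n : P (S n) = (fine (P (S n)))%:E.
  rewrite fineK// fin_num_measure//; apply: measurable_rejects => i.
  exact: measurable_funPT.
rewrite (_ : (fun n => _) = EFin \o (fun n => fine (P (S n)))); last first.
  by apply/funext => n; exact: SE.
apply: cvg_EFin; first by near=> n.
apply/cvgrPdist_le => dl dl0; near=> n.
have h : ((1 - dl)%:E <= P (S n))%E.
  by near: n; exact: probability_rejects_ge hL hV_indep hV_law hfaith _ _ dl0.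
have h1 : (P (S n) <= 1)%E.
  by apply: probability_le1; apply: measurable_rejects => i; exact: measurable_funPT.
move: h h1; rewrite SE !lee_fin /= => h h1.
by rewrite ger0_norm ?subr_ge0// lerBlDr -lerBlDl.
Unshelve. all: by end_near. Qed.
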